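(* In the normal-cell setting described in the context, fix one piece $\alpha$ with $d:=d_\alpha\ge1$ and suppress the index $\alpha$ from $P,F,J,\mathsf A$ and $\mathcal I$. Fix $\boldsymbol\beta\in(0,\infty)^d$ and put $Q=\sum_i\beta_i$. Let $c:P\to(0,\infty)$ be measurable (no uniform lower bound is assumed) and define $$b(p,s):=a(F(p,s))J(p,s),\qquad \phi(p,s):=\frac{f(F(p,s))-f_0}{c(p)} .$$ Let $G:P\times\mathbb R^d\to[0,\infty)$ be measurable with $G(p,D_u^{\boldsymbol\beta}t)=uG(p,t)$ for all $p,t$ and $u>0$, and suppose that for some $0<g_-\le g_+<\infty$ one has $g_-\le G(p,t)\le g_+$ for all $p\in P$ whenever $\rho_{\boldsymbol\beta}(t)=1$. Suppose that there are a measurable function $b_0:P\to\mathbb C$, sets $\mathsf A^\infty(p)\subset\mathbb R^d$ ($p\in P$) with measurable graph, and constants $\kappa_G>0$ and $0<\gamma\le\min\{1,\kappa_G\}$ with the following properties. For almost every $p$, $$b(p,s)\to b_0(p),\qquad \frac{\phi(p,s)}{G(p,s)}\to1\qquad\text{as }s\to0\ (s\neq0)\text{ within }\mathsf A(p),$$ and throughout the truncated cells (i.e. for $p\in P$, $s\in\mathsf A(p)\cap B_\varepsilon$), $\phi(p,s)\ge\kappa_GG(p,s)$. Moreover, for almost every $p$, $$\int_{\mathbb R^d}\Bigl|\mathbf 1_{D_{zc(p)}^{\boldsymbol\beta}(\mathsf A(p)\cap B_\varepsilon)}(t)-\mathbf 1_{\mathsf A^\infty(p)}(t)\Bigr|e^{-\gamma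 G(p,t)}\,dt\longrightarrow0\qquad(z\to\infty).$$ Finally, suppose there is a measurable $B:P\to[0,\infty)$ such that $|b(p,s)|\le B(p)$ on the truncated cells, $|b_0(p)|\le B(p)$, and $B(p)c(p)^{-Q}\in L^1(P,\mathrm{dvol}_P)$. Then, with $\mathcal L(p):=b_0(p)\int_{\mathsf A^\infty(p)}e^{-G(p,t)}\,dt$, one has as $z\to\infty$ $$I_\alpha(z)=e^{-zf_0}z^{-Q}\left[\int_Pc(p)^{-Q}\mathcal L(p)\,\mathrm{dvol}_P(p)+o(1)\right].$$
   Context: Setting. $(N,g)$ is a $C^2$ Riemannian manifold of dimension $n$ with Riemannian volume measure $\mathrm{dvol}_g$; $f:N\to\mathbb R$ is continuous and bounded below; $a:N\to\mathbb C$ is measurable; $f_0:=\inf_Nf$; $M:=\{x\in N:f(x)=f_0\}$ is nonempty and compact. $\mathcal T_\varepsilon(M):=\{x:\operatorname{dist}_g(x,M)<\varepsilon\}$; $B_r$ is the open Euclidean ball of radius $r$ at $0$ in the relevant dimension. $M=\bigsqcup_{j=0}^{\ell}\Sigma_j$ is a disjoint union of finitely many $C^2$ embedded strata, $\Sigma_j$ a (possibly empty or disconnected) $j$-dimensional submanifold. Normal-cell decomposition. There are $\varepsilon>0$ and a finite index set $\mathcal A$, and for each $\alpha\in\mathcal A$: a Borel set $P_\alpha\subset\Sigma_{j_\alpha}$ of finite $j_\alpha$-dimensional Riemannian volume, with $M=\bigsqcup_\alpha P_\alpha$; an open neighborhood $U_\alpha$ of $P_\alpha$ in $\Sigma_{j_\alpha}$;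 $d_\alpha:=n-j_\alpha$; a $C^1$ map $F_\alpha:U_\alpha\times B_\varepsilon\to N$ with $F_\alpha(p,0)=p$; and sets (cells) $\mathsf A_\alpha(p)\subset\mathbb R^{d_\alpha}$, $p\in P_\alpha$, with measurable graph $\{(p,s):s\in\mathsf A_\alpha(p)\}$. With $\mathfrak D_\alpha(\varepsilon):=\{(p,s):p\in P_\alpha,\ s\in\mathsf A_\alpha(p)\cap B_\varepsilon\}$, the sets $F_\alpha(\mathfrak D_\alpha(\varepsilon))$ are pairwise disjoint up to null sets and cover $\mathcal T_\varepsilon(M)$ up to a null set, and there are measurable $J_\alpha:\mathfrak D_\alpha(\varepsilon)\to(0,\infty)$ such that for every nonnegative measurable $h$ $$\int_{F_\alpha(\mathfrak D_\alpha(\varepsilon))}h\,\mathrm{dvol}_g=\int_{P_\alpha}\int_{\mathsf A_\alpha(p)\cap B_\varepsilon}h(F_\alpha(p,s))J_\alpha(p,s)\,ds\,\mathrm{dvol}_{P_\alpha}(p).$$ Here $\mathrm{dvol}_{P_\alpha}$ is the induced $j_\alpha$-dimensional Riemannian volume. For $z>0$ put $$\mathcal I_\alpha(z,p):=\int_{\mathsf A_\alpha(p)\cap B_\varepsilon}a(F_\alpha(p,s))J_\alpha(p,s)e^{-zf(F_\alpha(p,s))}\,ds,\qquad I_\alpha(z):=\int_{P_\alpha}\mathcal I_\alpha(z,p)\,\mathrm{dvol}_{P_\alpha}(p).$$ Dilations. For $\boldsymbol\beta\in(0,\infty)^d$, $u>0$: $D_u^{\boldsymbol\beta}t:=(u^{\beta_1}t_1,\dots,u^{\beta_d}t_d)$;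 $\rho_{\boldsymbol\beta}(0)=0$ and for $t\neq0$, $\rho_{\boldsymbol\beta}(t)$ is the unique $r>0$ with $|D_{1/r}^{\boldsymbol\beta}t|=1$. $\mathbf 1_E$ is the indicator of $E$. *)

(* Defs.v *)
From HB Require Import structures.
From mathcomp Require Import all_boot all_order all_algebra.
From mathcomp Require Import complex.
From mathcomp Require Import all_classical all_reals all_analysis.
From mathcomp Require Import measurable_realfun lra.

Set Implicit Arguments.
Unset Strict Implicit.
Unset Printing Implicit Defensive.

Import Order.TTheory GRing.Theory Num.Theory.
Import numFieldNormedType.Exports.

Local Open Scope classical_set_scope.
Local Open Scope ring_scope.

(* All measurability on manifolds and on R^d is with respect to Borel sets. *)
Notation Borel T := (g_sigma_algebraType (@open T)).

Section borel_product.

Lemma second_countable_open_prod (X Y : ptopologicalType) :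
  @second_countable X -> @second_countable Y ->
  forall W : set (X * Y), open W -> measurable (W : set (Borel X * Borel Y)).
Proof.
move=> [B cB [oB bB]] [C cC [oC bC]] W oW.
pose S := [set UV : set X * set Y | [/\ B UV.1, C UV.2 & UV.1 `*` UV.2 `<=` W]].
have cS : countable S.
  apply: (@sub_countable _ _ _ (B `*` C)); last exact: countableX.
  by apply: subset_card_le => -[U V] [].
have -> : W = \bigcup_(UV in S) (UV.1 `*` UV.2).
  rewrite eqEsubset; split => [[x y] Wxy|p [UV [_ _ UVW]] /UVW//].
  have : nbhs (x, y) W by exact: open_nbhs_nbhs.
  move=> [[P Q] /= [Px Qy] PQW].
  have [U [BU Ux] UP] := bB x _ Px.
  have [V [CV Vy] VQ] := bC y _ Qy.
  exists (U, V) => //; split => //= -[u v] /= [Uu Vv].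
  by apply: PQW; split; [exact: UP|exact: VQ].
have /pfcard_geP[->|[e]] := cS; first by rewrite bigcup_set0.
rewrite -(image_eq e) bigcup_image; apply: bigcupT_measurable => k.
have [BU CV _] : S (e k) by exact: funS.
apply: measurableX.
  by apply: sub_sigma_algebra; exact: oB.
by apply: sub_sigma_algebra; exact: oC.
Qed.

Lemma measurable_fun_Borel d (X : measurableType d) (Y : ptopologicalType)
    (f : X -> Borel Y) :
  (forall V : set Y, open V -> measurable (f @^-1` V)) -> measurable_fun setT f.
Proof.
move=> fV; apply: (@measurability _ _ X (Borel Y) setT f (@open Y)) => //.
by move=> _ [V oV <-]; rewrite setTI; exact: fV.
Qed.

Let inv_natS_small (R : realType) (e : R) : 0 < e ->
  exists k : nat, k.+1%:R^-1 < e.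
Proof.
move=> e0; near (\oo : set_system nat) => k; exists k.
by near: k; apply: (near_infty_natSinv_lt (PosNum e0)).
Unshelve. all: by end_near. Qed.

Let rat_ball (R : realType) (x e : R) : 0 < e ->
  exists q : rat, ball x e (ratr q).
Proof.
move=> e0; have := @dense_rat R (interior (ball x e)).
case; [|exact: open_interior|].
  by exists x; apply: nbhsx_ballx.
by move=> y [/interior_subset xq [q _ qE]]; exists q; rewrite qE.
Qed.

Lemma second_countable_R (R : realType) : @second_countable R.
Proof.
pose b (q : rat * nat) : set R := interior (ball (ratr q.1 : R) q.2.+1%:R^-1).
exists (range b).
  exact: card_le_trans (card_image_le _ _) (countableP _).
split; first by move=> _ [q _ <-]; exact: open_interior.
move=> x P /nbhs_ballP[e /= e0 eP].
have [k ke] : exists k : nat, k.+1%:R^-1 < e / 2 by apply: inv_natS_small; lra.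
have rk : (0 : R) < k.+1%:R^-1 / 2 by rewrite divr_gt0// invr_gt0 ltr0n.
have rke : k.+1%:R^-1 / 2 <= e / 2.
  by rewrite ler_pM2r ?invr_gt0// (le_trans (ltW ke))// ler_pdivrMr; lra.
have [q xq] := rat_ball x rk.
exists (b (q, k)); first split; first by exists (q, k).
  apply/nbhs_ballP; exists (k.+1%:R^-1 / 2) => //= y xy.
  exact: (@ball_splitr _ _ x).
move=> y /interior_subset/= qy; apply: eP; apply: (@ball_splitr _ R (ratr q)).
  by apply: ball_sym; apply: le_ball xq; exact: rke.
by apply: le_ball qy; exact: ltW.
Qed.

Lemma second_countable_rV (R : realType) d : @second_countable 'rV[R]_d.
Proof.
pose b (q : 'rV[rat]_d * nat) : set 'rV[R]_d :=
  interior (ball (map_mx ratr q.1 : 'rV[R]_d) q.2.+1%:R^-1).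
exists (range b).
  exact: card_le_trans (card_image_le _ _) (countableP _).
split; first by move=> _ [q _ <-]; exact: open_interior.
move=> x P /nbhs_ballP[e /= e0 eP].
have [k ke] : exists k : nat, k.+1%:R^-1 < e / 2 by apply: inv_natS_small; lra.
have rk : (0 : R) < k.+1%:R^-1 / 2 by rewrite divr_gt0// invr_gt0 ltr0n.
have rke : k.+1%:R^-1 / 2 <= e / 2.
  by rewrite ler_pM2r ?invr_gt0// (le_trans (ltW ke))// ler_pdivrMr; lra.
pose q : 'rV[rat]_d := \row_i projT1 (cid (rat_ball (x 0 i) rk)).
have xq : ball x (k.+1%:R^-1 / 2) (map_mx ratr q : 'rV[R]_d).
  by split => // i j; rewrite !mxE ord1; case: cid.
exists (b (q, k)); first split; first by exists (q, k).
  apply/nbhs_ballP; exists (k.+1%:R^-1 / 2) => //= y xy.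
  exact: (@ball_splitr _ _ x).
move=> y /interior_subset/= qy; apply: eP.
apply: (@ball_splitr _ _ (map_mx ratr q : 'rV[R]_d)).
  by apply: ball_sym; apply: le_ball xq; exact: rke.
by apply: le_ball qy; exact: ltW.
Qed.

End borel_product.

Section lebesgue_rV.
Variable R : realType.
Local Open Scope ereal_scope.

(* Lebesgue measure on R^d, by integrating the measures of slices. *)
Fixpoint lebesgue_rV d : set (Borel 'rV[R]_d) -> \bar R :=
  match d return set (Borel 'rV[R]_d) -> \bar R with
  | 0%N => fun A => (\1_A 0%R)%:E
  | d'.+1 => fun A : set 'rV[R]_(1 + d') =>
      \int[lebesgue_measure]_x lebesgue_rV [set v | A (row_mx x%:M v)]
  end.

Let consrV d (xv : R * 'rV[R]_d) : 'rV[R]_(1 + d) := row_mx xv.1%:M xv.2.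

Let consrV_continuous d : continuous (@consrV d).
Proof.
move=> [x v] A /nbhs_ballP[e /= e0 eA]; apply/nbhs_ballP; exists e => //.
move=> [y w] xyvw; have [/= xy vw] := xyvw; apply: eA; split=> // i j.
rewrite !mxE; case: fintype.splitP => k _.
  by rewrite !mxE !ord1 eqxx.
by have [_] := vw; apply.
Qed.

Let measurable_consrV d :
  measurable_fun setT (@consrV d : R * Borel 'rV[R]_d -> Borel 'rV[R]_(1 + d)).
Proof.
apply: measurable_fun_Borel => V oV.
have oP : open (@consrV d @^-1` V).
  by apply: open_comp => // x _; exact: consrV_continuous.
have /= mO := second_countable_open_prod (@second_countable_R R)
  (@second_countable_rV R d) oP.
have /(_ measurableT _ mO) : measurable_fun setT
    (id : R * Borel 'rV[R]_d -> Borel R * Borel 'rV[R]_d).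
  apply/measurable_fun_pairP; split; last exact: measurable_snd.
  apply: measurable_fun_Borel => U oU.
  rewrite -[X in measurable X]setTI; apply: measurable_fst => //.
  exact: open_measurable.
by rewrite setTI.
Qed.

Let unconsrV d (w : 'rV[R]_(1 + d)) : R * 'rV[R]_d :=
  (w 0%R (lshift d 0%R), rsubmx w).

Let unconsrVK d : cancel (@consrV d) (@unconsrV d).
Proof. by move=> [x v]; rewrite /unconsrV row_mxEl row_mxKr mxE eqxx. Qed.

Let measurable_unconsrV d :
  measurable_fun setT (@unconsrV d : Borel 'rV[R]_(1 + d) -> R * Borel 'rV[R]_d).
Proof.
apply: measurable_fun_pair.
  apply: (measurability _ (RGenOpens.measurableE R)).
  move=> _ [_ [a [b ->] <-]]; rewrite setTI; apply: sub_sigma_algebra.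
  apply: open_comp; last exact: interval_open.
  by move=> w _; exact: coord_continuous.
apply: measurable_fun_Borel => V oV.
apply: sub_sigma_algebra; apply: open_comp => // w _.
move=> A /nbhs_ballP[e /= e0 eA]; apply/nbhs_ballP; exists e => //.
move=> w' [_ ww']; apply: eA; split=> // i k.
by rewrite !mxE; exact: ww'.
Qed.

Section cons_measure.
Variables (d : nat) (m : {sigma_finite_measure set (Borel 'rV[R]_d) -> \bar R}).

Let p (A : set (Borel 'rV[R]_(1 + d))) : \bar R :=
  (lebesgue_measure \x m) (@consrV d @^-1` A).

Let p0 : p set0 = 0.
Proof. by rewrite /p preimage_set0 measure0. Qed.

Let p_ge0 A : 0 <= p A.
Proof. exact: measure_ge0. Qed.

Let p_additive : semi_sigma_additive p.
Proof.
move=> F mF tF mUF; rewrite /p preimage_bigcup.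
apply: measure_semi_sigma_additive.
- by move=> n; rewrite -[X in measurable X]setTI; exact: measurable_consrV.
- apply/trivIsetP => /= i j _ _ ij; rewrite -preimage_setI.
  by move/trivIsetP : tF => /(_ _ _ _ _ ij) ->//; rewrite preimage_set0.
- by rewrite -preimage_bigcup -[X in measurable X]setTI; exact: measurable_consrV.
Qed.

HB.instance Definition _ := isMeasure.Build _ _ _ p p0 p_ge0 p_additive.

Let p_sigma_finite : sigma_finite setT p.
Proof.
have /sigma_finiteP[F [TF ndF Foo]] := sigma_finiteT (@lebesgue_measure R).
have /sigma_finiteP[G [TG ndG Goo]] := sigma_finiteT m.
exists (fun k => @unconsrV d @^-1` (F k `*` G k)).
  rewrite -preimage_bigcup; apply/esym/seteqP; split => // w _ /=.
  have [i _ Fi] : (\bigcup_i F i) (w 0%R (lshift d 0%R)) by rewrite -TF.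
  have [j _ Gj] : (\bigcup_i G i) (rsubmx w) by rewrite -TG.
  exists (maxn i j) => //; split => /=.
    by move: Fi; exact/subsetPset/ndF/leq_maxl.
  by move: Gj; exact/subsetPset/ndG/leq_maxr.
move=> k; have [mF Fk] := Foo k; have [mG Gk] := Goo k; split.
  rewrite -[X in measurable X]setTI; apply: measurable_unconsrV => //.
  exact: measurableX.
rewrite /p -comp_preimage (_ : _ \o _ = id) ?preimage_id; last first.
  by apply/funext => x /=; rewrite unconsrVK.
by rewrite product_measure1E// lte_mul_pinfty// ge0_fin_numE.
Qed.

HB.instance Definition _ := Measure_isSigmaFinite.Build _ _ _ p p_sigma_finite.

Lemma cons_measureE : exists p : {sigma_finite_measure set _ -> \bar R},
  p = (fun A : set (Borel 'rV[R]_(1 + d)) =>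
    \int[lebesgue_measure]_x m [set v | A (row_mx x%:M v)]) :> (_ -> _).
Proof.
exists p; apply/funext => A; apply: eq_integral => x _ /=; congr (m _).
by apply/seteqP; split => v /=; rewrite /xsection /= inE.
Qed.

End cons_measure.

Let lebesgue_rV_measure d :
  exists m : {sigma_finite_measure set (Borel 'rV[R]_d) -> \bar R},
    m = @lebesgue_rV d :> (_ -> _).
Proof.
elim: d => [|d [m mE]].
  by exists (dirac (0%R : Borel 'rV[R]_0)).
by have [p pE] := cons_measureE m; exists p; rewrite pE mE.
Qed.

Section instances.
Variable d : nat.
Notation leb := (@lebesgue_rV d : set (Borel 'rV[R]_d) -> \bar R).

Let leb0 : leb set0 = 0.
Proof. by have [m <-] := lebesgue_rV_measure d; exact: measure0. Qed.

Let leb_ge0 A : 0 <= leb A.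
Proof. by have [m <-] := lebesgue_rV_measure d; exact: measure_ge0. Qed.

Let leb_additive : semi_sigma_additive leb.
Proof.
by have [m <-] := lebesgue_rV_measure d; exact: measure_semi_sigma_additive.
Qed.

HB.instance Definition _ := isMeasure.Build _ _ _ leb leb0 leb_ge0 leb_additive.

Let leb_sigma_finite : sigma_finite setT leb.
Proof.
by have [m <-] := lebesgue_rV_measure d; exact: sigma_finiteT.
Qed.

HB.instance Definition _ :=
  Measure_isSigmaFinite.Build _ _ _ leb leb_sigma_finite.

End instances.

End lebesgue_rV.

Section complex_valued.
Context d (T : measurableType d) (R : realType).
Implicit Types (mu : {measure set T -> \bar R}) (D : set T) (h : T -> R[i]).

Definition cmeasurable_fun D h :=
  measurable_fun D (fun x => complex.Re (h x)) /\
  measurable_fun D (fun x => complex.Im (h x)).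

Definition cintegrable mu D h :=
  mu.-integrable D (fun x => (complex.Re (h x))%:E) /\
  mu.-integrable D (fun x => (complex.Im (h x))%:E).

Definition cintegral mu D h : R[i] :=
  Complex (Rintegral mu D (fun x => complex.Re (h x)))
          (Rintegral mu D (fun x => complex.Im (h x))).

End complex_valued.

Section Ck.
Context (R : realType) (m k : nat).
Implicit Types (U : set 'rV[R]_m) (h : 'rV[R]_m -> 'rV[R]_k).

(* Meant for open [U]. *)
Definition C1_on U h := forall x, U x ->
  differentiable h x /\ {for x, continuous (jacobian h)}.

End Ck.

Definition C2_on (R : realType) m k (U : set 'rV[R]_m)
    (h : 'rV[R]_m -> 'rV[R]_k) :=
  C1_on U h /\ C1_on U (fun x => mxvec (jacobian h x)).

Section riemannian_manifold.
Context (R : realType) (N : ptopologicalType) (n : nat).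

(* The values of [coord] outside [dom], and of [param] outside the image of
   [dom], are junk. *)
Record chart := Chart {
  dom : set N;
  coord :> N -> 'rV[R]_n;
  param : 'rV[R]_n -> N }.

Definition img (c : chart) : set 'rV[R]_n := c @` dom c.

Definition is_chart (c : chart) :=
  [/\ open (dom c), open (img c),
      forall x, dom c x -> param c (c x) = x,
      forall x, dom c x -> {for x, continuous (coord c)} &
      forall y, img c y -> {for y, continuous (param c)}].

Definition compatible (c c' : chart) :=
  C2_on (c @` (dom c `&` dom c')) (c' \o param c) /\
  C2_on (c' @` (dom c `&` dom c')) (c \o param c').

(* [metric c x] is the Gram matrix at [x] of the coordinate frame of [c].  On
   a C^2 manifold the metric tensor is a C^1 section.  Vectors are rows, so
   [v *m jacobian h y] is the derivative of [h] at [y] along [v]. *)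
Record riemannian := Riemannian {
  atlas : set chart;
  manifold_hausdorff : hausdorff_space N;
  manifold_second_countable : @second_countable N;
  atlas_chart : forall c, atlas c -> is_chart c;
  atlas_cover : forall x, exists2 c, atlas c & dom c x;
  atlas_compatible : forall c c', atlas c -> atlas c' -> compatible c c';
  atlas_maximal : forall c, is_chart c ->
    (forall c', atlas c' -> compatible c c') -> atlas c;
  metric : chart -> N -> 'M[R]_n;
  metric_sym : forall c x, atlas c -> dom c x -> (metric c x)^T = metric c x;
  metric_pos : forall c x (v : 'rV[R]_n), atlas c -> dom c x -> v != 0 ->
    0 < (v *m metric c x *m v^T) 0 0;
  metric_C1 : forall c, atlas c ->
    C1_on (img c) (fun y => mxvec (metric c (param c y)));
  metric_change : forall c c' x, atlas c -> atlas c' -> dom c x -> dom c' x ->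
    let T := jacobian (c' \o param c) (c x) in
    metric c x = T *m metric c' x *m T^T }.

Variable g : riemannian.

(* C^1 curves inside a chart, parametrized by [0, 1] (any C^1 function on
   [0, 1] is the restriction of one on the line). *)
Definition chart_curve (c : chart) (x : R -> 'rV[R]_n) :=
  [/\ atlas g c, (forall t, derivable x t 1), continuous (derive1 x) &
      forall t, 0 <= t <= 1 -> img c (x t)].

Definition curve_length (c : chart) (x : R -> 'rV[R]_n) : R :=
  Rintegral lebesgue_measure `[0, 1] (fun t => Num.sqrt
    ((derive1 x t *m metric g c (param c (x t)) *m (derive1 x t)^T) 0 0)).

(* [path_length p q l]: some piecewise C^1 path from [p] to [q], subdivided
   so that each piece lies in one chart, has length [l]. *)
Inductive path_length : N -> N -> R -> Prop :=
| path_nil p : path_length p p 0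
| path_cons c x q l : chart_curve c x -> path_length (param c (x 1)) q l ->
    path_length (param c (x 0)) q (curve_length c x + l).

Definition dist (p q : N) : \bar R :=
  ereal_inf [set l%:E | l in path_length p q].

Definition dist_set (p : N) (A : set N) : \bar R :=
  ereal_inf [set dist p q | q in A].

Definition tube (e : R) (A : set N) := [set x | (dist_set x A < e%:E)%E].

Definition slice_chart (j : nat) (S : set N) (c : chart) :=
  atlas g c /\
  forall x, dom c x -> (S x <-> forall i : 'I_n, (j <= i)%N -> c x 0 i = 0).

Definition submanifold (j : nat) (S : set N) := forall p, S p ->
  (j <= n)%N /\ exists2 c, slice_chart j S c & dom c p.

(* The inclusion of R^j as the first [j] coordinates of R^n. *)
Definition incl j (y : 'rV[R]_j) : 'rV[R]_n := y *m pid_mx j.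

(* The metric induced on a [j]-dimensional submanifold, in the first [j]
   coordinates of a slice chart. *)
Definition induced_metric j (c : chart) (x : N) : 'M[R]_j :=
  pid_mx j *m metric g c x *m (pid_mx j)^T.

(* The Riemannian volume of the [j]-dimensional submanifold [S], as a Borel
   measure on [N] carried by [S]: it is determined by its values in slice
   charts.  For [j = n] and [S = setT] this is the volume of [N]; for [j = 0]
   it is the counting measure. *)
Definition is_riemannian_volume (j : nat) (S : set N)
    (mu : {measure set (Borel N) -> \bar R}) :=
  mu.-negligible (~` S) /\
  forall c, slice_chart j S c ->
  forall B : set (Borel N), measurable B -> B `<=` dom c ->
    (mu B = \int[@lebesgue_rV R j]_(y in [set y | (c @` B) (incl y)])
              (Num.sqrt (\det (induced_metric j c (param c (incl y)))))%:E)%E.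

End riemannian_manifold.

(* Only the values of [cF] on [cU `*` eball eps], of [cA] on [cP], and of [cJ]
   on the truncated cells below are meaningful. *)
Record cell (R : realType) (N : ptopologicalType) (n : nat) := Cell {
  cj : nat;
  cP : set N;
  cU : set N;
  cF : N -> 'rV[R]_(n - cj) -> N;
  cA : N -> set 'rV[R]_(n - cj);
  cJ : N -> 'rV[R]_(n - cj) -> R }.

Arguments cF {R N n} K p s : rename.
Arguments cA {R N n} K p _ : rename.
Arguments cJ {R N n} K p s : rename.

Unset Implicit Arguments.

Section normal_cells.
Context (R : realType) (N : ptopologicalType) (n : nat).

Definition enorm {d} (s : 'rV[R]_d) : R := Num.sqrt (\sum_(i < d) s 0 i ^+ 2).

Definition eball {d} (r : R) : set 'rV[R]_d := [set s | enorm s < r].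

Definition argmin_set (f : N -> R) : set N := [set x | f x = inf (range f)].

Definition stratification (g : riemannian R N n) (M : set N) (l : nat)
    (Sigma : nat -> set N) :=
  [/\ forall j, (j <= l)%N -> submanifold g j (Sigma j),
      trivIset [set j | (j <= l)%N] Sigma &
      M = \bigcup_(j in [set j | (j <= l)%N]) Sigma j].

Local Notation cell := (cell R N n).

Definition codim (K : cell) := (n - cj K)%N.

Definition trunc (eps : R) (K : cell) (p : N) : set (Borel 'rV[R]_(codim K)) :=
  cA K p `&` eball eps.

Definition cell_dom (eps : R) (K : cell) :
    set (Borel N * Borel 'rV[R]_(codim K)) :=
  [set ps | cP K ps.1 /\ trunc eps K ps.1 ps.2].

Definition cell_map (K : cell) (ps : N * 'rV[R]_(codim K)) : N :=
  cF K ps.1 ps.2.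

Definition cell_img (eps : R) (K : cell) : set (Borel N) :=
  cell_map K @` cell_dom eps K.

(* [cF] is C^1 on [cU `*` eball eps], where [cU] is an open subset of the
   [j]-dimensional submanifold [S]: it is continuous, and C^1 in slice charts
   of [S] and charts of [N]. *)
Definition C1_cell_map (g : riemannian R N n) (S : set N) (eps : R)
    (K : cell) :=
  {within cU K `*` @eball (codim K) eps, continuous (cell_map K)} /\
  forall c c', slice_chart g (cj K) S c -> atlas g c' ->
    let base (w : 'rV[R]_(cj K + codim K)) := param c (incl n (lsubmx w)) in
    let Fw w := cF K (base w) (rsubmx w) in
    C1_on [set w | [/\ img c (incl n (lsubmx w)), cU K (base w),
                       eball eps (rsubmx w) & dom c' (Fw w)]]
      (fun w => c' (Fw w)).

(* The image of a truncated cell is analytic but perhaps not Borel; for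
   nonnegative integrands the integral over it is then the one with respect to
   the completion of [vol]. *)
Definition is_normal_cell (g : riemannian R N n)
    (vol : {measure set (Borel N) -> \bar R}) (S : set N)
    (volS : {measure set (Borel N) -> \bar R}) (eps : R) (K : cell) :=
  [/\ [/\ measurable (cP K : set (Borel N)), cP K `<=` S &
          (volS (cP K) < +oo)%E],
      (exists2 V, open V & cU K = S `&` V) /\ cP K `<=` cU K,
      C1_cell_map g S eps K /\ (forall p, cU K p -> cF K p (0 : 'rV_(codim K)) = p),
      measurable ([set ps | cP K ps.1 /\ cA K ps.1 ps.2] :
        set (Borel N * Borel 'rV[R]_(codim K))) &
      [/\ measurable_fun (cell_dom eps K) (fun ps => cJ K ps.1 ps.2),
          forall ps, cell_dom eps K ps -> 0 < cJ K ps.1 ps.2 &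
          forall h : Borel N -> \bar R, measurable_fun setT h ->
            (forall x, (0 <= h x)%E) ->
            (\int[vol]_(x in cell_img eps K) h x =
             \int[volS]_(p in cP K)
               \int[@lebesgue_rV R (codim K)]_(s in trunc eps K p)
                 (h (cF K p s) * (cJ K p s)%:E))%E]].

Definition normal_cell_decomposition (g : riemannian R N n)
    (vol : {measure set (Borel N) -> \bar R}) (l : nat) (Sigma : nat -> set N)
    (volS : nat -> {measure set (Borel N) -> \bar R}) (M : set N) (eps : R)
    (I : finType) (K : I -> cell) :=
  [/\ forall i, (cj (K i) <= l)%N /\
        is_normal_cell g vol (Sigma (cj (K i))) (volS (cj (K i))) eps (K i),
      trivIset setT (fun i => cP (K i)) /\ M = \bigcup_i cP (K i),
      forall i i', i != i' ->
        vol.-negligible (cell_img eps (K i) `&` cell_img eps (K i')) &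
      vol.-negligible (tube g eps M `\` \bigcup_i cell_img eps (K i))].

End normal_cells.

Arguments enorm {R d} s.
Arguments eball {R d} r _.
Arguments argmin_set {R N} f _.
Arguments stratification {R N n} g M l Sigma.
Arguments codim {R N n} K.
Arguments trunc {R N n} eps K p _.
Arguments cell_dom {R N n} eps K _.
Arguments cell_map {R N n} K ps.
Arguments cell_img {R N n} eps K _.
Arguments C1_cell_map {R N n} g S eps K.
Arguments is_normal_cell {R N n} g vol S volS eps K.
Arguments normal_cell_decomposition {R N n} g vol l Sigma volS M eps {I} K.

Section cell_integrals.
Context (R : realType) (N : ptopologicalType) (n : nat).
Variables (volP : {measure set (Borel N) -> \bar R}) (f : N -> R)
  (a : N -> R[i]) (eps : R) (K : cell R N n).

Definition amplitude (p : N) (s : 'rV[R]_(codim K)) : R[i] :=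
  a (cF K p s) * (cJ K p s)%:C%C.

Definition inner_integrand (z : R) (p : N) (s : 'rV[R]_(codim K)) : R[i] :=
  amplitude p s * (expR (- z * f (cF K p s)))%:C%C.

Definition inner_integral (z : R) (p : N) : R[i] :=
  cintegral (@lebesgue_rV R (codim K)) (trunc eps K p) (inner_integrand z p).

Definition outer_integral (z : R) : R[i] :=
  cintegral volP (cP K) (inner_integral z).

End cell_integrals.

Arguments amplitude {R N n} a K p s.
Arguments inner_integrand {R N n} f a K z p s.
Arguments inner_integral {R N n} f a eps K z p.
Arguments outer_integral {R N n} volP f a eps K z.

Set Implicit Arguments.

Section dilations.
Context (R : realType) (d : nat) (beta : 'rV[R]_d).

Definition dil (u : R) (t : 'rV[R]_d) : 'rV[R]_d :=
  \row_i (u `^ beta 0 i * t 0 i).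

(* For [t != 0] and positive [beta], exactly one [r] qualifies. *)
Definition rho (t : 'rV[R]_d) : R :=
  if t == 0 then 0 else get [set r | 0 < r /\ enorm (dil r^-1 t) = 1].

End dilations.

Arguments dil {R d} beta u t.
Arguments rho {R d} beta t.

(* Main.v *)
Require Import Defs.
From HB Require Import structures.
From mathcomp Require Import all_boot all_order all_algebra.
From mathcomp Require Import complex.
From mathcomp Require Import all_classical all_reals all_analysis.
From mathcomp Require Import measurable_realfun lra ring.

Set Implicit Arguments.
Unset Strict Implicit.
Unset Printing Implicit Defensive.

Import Order.TTheory GRing.Theory Num.Theory.
Import numFieldNormedType.Exports.
Import Normc.

Local Open Scope classical_set_scope.
Local Open Scope ring_scope.

(* Substituting [s = dil beta (z * c p)^-1 t] in the inner integral turns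
   [expR (z * f0) * (z * c p) `^ Q] times it into the integral over the dilated
   cell of [b(p, s) exp(- z c(p) phi(p, s))].  Since [z c(p) phi(p, s) =
   (phi / G)(p, s) * G(p, t)] by homogeneity, this integrand tends pointwise to
   [b0(p) exp(- G(p, t))] and is dominated by [B(p) exp(- gamma G(p, t))], whose
   integral over [t] is bounded by a constant times [B(p)], uniformly in [p],
   because [G] dominates the quasi-norm.  Dominated convergence in [t], together
   with the assumed convergence of the dilated cells, gives the limit of the
   rescaled inner integral for almost every [p]; dominated convergence in [p],
   with majorant a multiple of [B * c `^ (- Q)], gives the theorem.  Complex
   amplitudes are treated through their real and imaginary parts. *)

(** * Lebesgue measure under anisotropic dilations *)

Section dilation.
Variable R : realType.
Local Open Scope ereal_scope.

(** The second hypothesis says that the image of [mu] under [phi] is [k] times [nu], so the change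
    of variables reduces to integration against an image measure and no Jacobian is computed. *)
Lemma ge0_integral_comp_scale d1 d2 (X : measurableType d1)
    (Y : measurableType d2) (mu : {measure set X -> \bar R})
    (nu : {measure set Y -> \bar R}) (phi : X -> Y) (k : {nonneg R})
    (h : Y -> \bar R) :
  measurable_fun setT phi ->
  (forall A, measurable A -> mu (phi @^-1` A) = k%:num%:E * nu A) ->
  measurable_fun setT h -> (forall y, 0 <= h y) ->
  \int[mu]_x h (phi x) = k%:num%:E * \int[nu]_y h y.
Proof.
move=> mphi munu mh h0; rewrite -ge0_integral_mscale//.
transitivity (\int[pushforward mu phi]_y h y).
  by rewrite ge0_integral_pushforward.
by apply: eq_measure_integral => A mA _; exact: munu.
Qed.

(** By uniqueness of Lebesgue measure: [k] times its image under multiplication by [k] has the right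
    value on half-open intervals. *)
Lemma lebesgue_measure_scale (k : R) (A : set R) : (0 < k)%R -> measurable A ->
  lebesgue_measure ( *%R k @^-1` A) = k^-1%:E * lebesgue_measure A.
Proof.
move=> k0 mA; have kn0 : (0 <= k)%R := ltW k0.
have uniq (m : {measure set (measurableTypeR R) -> \bar R}) :
    (forall X, ocitv X -> lebesgue_measure X = k%:E * m X) ->
    lebesgue_measure A = k%:E * m A.
  move=> mE; exact: (@lebesgue_measure_unique R (mscale (NngNum kn0) m) mE).
suff -> : lebesgue_measure A = k%:E * pushforward lebesgue_measure
    ( *%R k : _ -> measurableTypeR R) A.
  by rewrite muleA -EFinM mulVf ?gt_eqF// mul1e.
apply: uniq => //= _ [[a b]] _ <-; rewrite /pushforward.
rewrite (_ : _ @^-1` _ = `](a / k)%R, (b / k)%R]%classic); last first.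
  apply/seteqP; split => x /=;
    by rewrite !in_itv/= ltr_pdivrMr// ler_pdivlMr// !(mulrC x).
rewrite !lebesgue_measure_itv/= !lte_fin ltr_pM2r ?invr_gt0//.
case: ifP => _; last by rewrite mule0.
by rewrite -!EFinB -EFinM -mulrBl mulrCA mulfV ?mulr1// gt_eqF.
Qed.

Lemma ge0_integral_lebesgue_scale (k : R) (h : R -> \bar R) : (0 < k)%R ->
  measurable_fun setT h -> (forall x, 0 <= h x) ->
  \int[lebesgue_measure]_x h (k * x)%R =
  k^-1%:E * \int[lebesgue_measure]_x h x.
Proof.
move=> k0 mh h0; have kV0 : (0 <= k^-1)%R by rewrite invr_ge0 ltW.
apply: (ge0_integral_comp_scale (k := NngNum kV0)) => // A mA.
exact: lebesgue_measure_scale.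
Qed.

(** The source carries the product of the Borel sigma-algebras. Continuity only makes preimages of
    open sets open in the product topology; second countability of the factors makes them
    measurable. *)
Lemma measurable_row_mx d (A : set 'rV[R]_(1 + d)) :
  measurable (A : set (Borel 'rV[R]_(1 + d))) ->
  measurable ([set xv | A (row_mx xv.1%:M xv.2)] : set (R * Borel 'rV[R]_d)).
Proof.
move=> mA.
pose r (xv : R * 'rV[R]_d) : 'rV[R]_(1 + d) := row_mx xv.1%:M xv.2.
have rc : continuous r.
  move=> [x v] B /nbhs_ballP[e /= e0 eB]; apply/nbhs_ballP; exists e => //.
  move=> [y w] [/= xy [_ vw]]; apply: eB; split=> // i j.
  rewrite !mxE; case: fintype.splitP => k _; last exact: vw.
  by rewrite !mxE !ord1 eqxx.
have : measurable_fun setT (r : R * Borel 'rV[R]_d -> Borel 'rV[R]_(1 + d)).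
  apply: measurable_fun_Borel => V oV.
  have /= mO := second_countable_open_prod (@second_countable_R R)
    (@second_countable_rV R d) (open_comp (fun x _ => rc x) oV).
  have : measurable_fun setT
      (id : R * Borel 'rV[R]_d -> Borel R * Borel 'rV[R]_d).
    apply/measurable_fun_pairP; split; last exact: measurable_snd.
    apply: measurable_fun_Borel => U oU.
    rewrite -[X in measurable X]setTI; apply: measurable_fst => //.
    exact: open_measurable.
  by move=> /(_ measurableT _ mO); rewrite setTI.
by move=> /(_ measurableT _ mA); rewrite setTI.
Qed.

Lemma measurable_slice d (A : set 'rV[R]_(1 + d)) :
  measurable (A : set (Borel 'rV[R]_(1 + d))) ->
  forall x, measurable ([set v | A (row_mx x%:M v)] : set (Borel 'rV[R]_d)).
Proof.
move=> /measurable_row_mx mA x; have := measurable_xsection x mA.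
by congr measurable; apply/seteqP; split => v /=; rewrite /xsection/= inE.
Qed.

Lemma measurable_lebesgue_slice d (A : set 'rV[R]_(1 + d)) :
  measurable (A : set (Borel 'rV[R]_(1 + d))) ->
  measurable_fun setT (fun x : R => @lebesgue_rV R d [set v | A (row_mx x%:M v)]).
Proof.
move=> /measurable_row_mx mA.
have := measurable_fun_xsection (@lebesgue_rV R d) mA.
congr measurable_fun; apply/funext => x /=; congr lebesgue_rV.
by apply/seteqP; split => v /=; rewrite /xsection/= inE.
Qed.

Lemma dil_row_mx d (beta : 'rV[R]_(1 + d)) u x (v : 'rV[R]_d) :
  dil beta u (row_mx x%:M v) =
  row_mx (u `^ beta 0%R (lshift d 0%R) * x)%R%:M (dil (rsubmx beta) u v).
Proof.
apply/rowP => i; rewrite !mxE.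
case: fintype.splitP => k ik; rewrite !mxE.
  rewrite !ord1 eqxx !mulr1n; congr (_ `^ beta 0%R _ * _)%R.
  by apply/val_inj; rewrite /= ik ord1.
by congr (_ `^ beta 0%R _ * _)%R; apply/val_inj.
Qed.

Lemma continuous_dil d (beta : 'rV[R]_d) u : continuous (dil beta u).
Proof.
move=> t B /nbhs_ballP[e /= e0 eB].
have FF : Filter (nbhs (t : 'rV[R]_d)) by exact: nbhs_filter.
have h i : nbhs (t : 'rV[R]_d)
    [set s | ball (dil beta u t 0%R i) e (dil beta u s 0%R i)].
  have : dil beta u s 0%R i @[s --> t] --> dil beta u t 0%R i.
    under eq_fun do rewrite mxE; rewrite mxE.
    exact: (cvg_comp _ _ (@coord_continuous R 1 d 0%R i t)
      (@mulrl_continuous R (u `^ beta 0%R i) (t 0%R i))).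
  by apply; apply: nbhsx_ballx.
apply: (@filterS _ _ FF _ _ _ (@filter_forall _ _ _ _ FF h)).
by move=> s st; apply: eB; split=> // i j; rewrite ord1; exact: st.
Qed.

Lemma measurable_dil d (beta : 'rV[R]_d) u :
  measurable_fun setT (dil beta u : Borel 'rV[R]_d -> Borel 'rV[R]_d).
Proof.
apply: measurable_fun_Borel => V oV; apply: sub_sigma_algebra.
by apply: open_comp => // x _; exact: continuous_dil.
Qed.

(** Induction along the recursive definition of [lebesgue_rV]: the slice at [x] of the preimage is
    the preimage, under the dilation of the remaining coordinates, of the slice of [A] at
    [u ^ beta_0 * x]. The induction hypothesis scales the slices, and scaling on the line handles
    the outer integral. *)
Lemma lebesgue_rV_dil d (beta : 'rV[R]_d) (u : R) (A : set (Borel 'rV[R]_d)) :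
  (0 < u)%R -> measurable A ->
  lebesgue_rV (dil beta u @^-1` A) =
  (u `^ - (\sum_i beta 0 i))%R%:E * lebesgue_rV A.
Proof.
elim: d beta A => [|d IH] beta A u0 mA /=.
  rewrite big_ord0 oppr0 powRr0 mul1e (_ : dil beta u @^-1` A = A)//.
  by apply/seteqP; split=> v /=; rewrite (_ : dil beta u v = v)//;
    apply/rowP => -[].
pose b1 : 'rV[R]_(1 + d) := beta.
under eq_integral => x _.
  rewrite [X in lebesgue_rV X](_ : _ = dil (rsubmx b1) u @^-1`
    [set v | A (row_mx (u `^ b1 0%R (@lshift 1 d 0%R) * x)%R%:M v)]); last first.
    by apply/seteqP; split => v /=; rewrite -dil_row_mx.
  rewrite IH//; last exact: measurable_slice mA _.
  over.
have b0 : (0 < u `^ b1 0%R (@lshift 1 d 0%R))%R by rewrite powR_gt0.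
have ms := measurable_lebesgue_slice mA.
rewrite ge0_integralZl//=; last 2 first.
- by apply: (measurableT_comp ms); exact: mulrl_measurable.
- exact: powR_ge0.
rewrite (@ge0_integral_lebesgue_scale _
  (fun x => lebesgue_rV [set v | A (row_mx x%:M v)]))//.
rewrite muleA -EFinM -powRN -powRD; last by rewrite (gt_eqF u0) implybT.
congr ((_ `^ _)%:E * _); rewrite addrC big_ord_recl opprD.
congr (- b1 _ _ - _)%R; first exact: val_inj.
by apply: eq_bigr => i _; rewrite mxE; congr (b1 _ _); exact: val_inj.
Qed.

End dilation.

Lemma continuous_measurable_Borel (R : realType) (X : ptopologicalType)
    (h : X -> R) :
  continuous h -> measurable_fun setT (h : Borel X -> R).
Proof.
move=> ch; apply: (measurability _ (RGenOpens.measurableE R)).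
move=> _ [_ [a [b ->] <-]]; rewrite setTI; apply: sub_sigma_algebra.
by apply: open_comp; [move=> x _; exact: ch|exact: interval_open].
Qed.

Lemma powRV (R : realType) (u b : R) : 0 < u -> u^-1 `^ b = (u `^ b)^-1.
Proof.
move=> u0; have ub : 0 < u `^ b by rewrite powR_gt0.
apply: (mulfI (lt0r_neq0 ub)).
by rewrite -powRM ?invr_ge0 ?ltW// !mulfV ?gt_eqF// powR1.
Qed.

(** * Homogeneous functions *)

Section quasinorm.
Context (R : realType) (d : nat) (beta : 'rV[R]_d).
Hypothesis beta_gt0 : forall i, 0 < beta 0 i.

Lemma dil1 (t : 'rV[R]_d) : dil beta 1 t = t.
Proof. by apply/rowP => i; rewrite !mxE powR1 mul1r. Qed.

Lemma dilM u v (t : 'rV[R]_d) : 0 <= u -> 0 <= v ->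
  dil beta u (dil beta v t) = dil beta (u * v) t.
Proof. by move=> u0 v0; apply/rowP => i; rewrite !mxE powRM// mulrA. Qed.

Lemma dilK u : 0 < u -> cancel (dil beta u) (dil beta u^-1).
Proof.
by move=> u0 t; rewrite dilM ?invr_ge0 ?ltW// mulVf ?gt_eqF// dil1.
Qed.

Lemma dilVK u : 0 < u -> cancel (dil beta u^-1) (dil beta u).
Proof.
by move=> u0 t; rewrite dilM ?invr_ge0 ?ltW// mulfV ?gt_eqF// dil1.
Qed.

Lemma image_dil u (A : set 'rV[R]_d) : 0 < u ->
  dil beta u @` A = dil beta u^-1 @^-1` A.
Proof.
move=> u0; apply/seteqP; split => t /=; first by move=> [s As <-]; rewrite dilK.
by move=> At; exists (dil beta u^-1 t) => //; rewrite dilVK.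
Qed.

(** Each factor [u ^ beta_i] lies in [(0, 1)] because [beta_i > 0], and some nonzero coordinate
    shrinks strictly. This is what makes the [r] in the definition of [rho] unique. *)
Lemma enorm_dil_lt u (s : 'rV[R]_d) : 0 < u -> u < 1 -> s != 0 ->
  enorm (dil beta u s) < enorm s.
Proof.
move=> u0 u1 s0.
have ub i : 0 < u `^ beta 0 i < 1.
  have p1 : 1 `^ beta 0 i = 1 :> R by rewrite powR1.
  by rewrite powR_gt0//= -[ltRHS]p1 gt0_ltr_powR// nnegrE ltW.
have le i : (dil beta u s 0 i) ^+ 2 <= s 0 i ^+ 2.
  have /andP[? ?] := ub i.
  by rewrite mxE exprMn ler_piMl ?sqr_ge0// expr_le1// ltW.
have [i si0] : exists i, s 0 i != 0.
  apply/existsP; apply: contraNT s0 => /existsPn s0.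
  by apply/eqP/rowP => i; rewrite mxE; apply/eqP; rewrite -[_ == _]negbK s0.
have lt : (dil beta u s 0 i) ^+ 2 < s 0 i ^+ 2.
  have /andP[? ?] := ub i.
  rewrite mxE exprMn gtr_pMl; last by rewrite exprn_even_gt0.
  by rewrite expr_lt1 ?ltW.
have gt0 : 0 < \sum_i s 0 i ^+ 2.
  rewrite (bigD1 i)//= ltr_pwDl ?sumr_ge0//; last by move=> *; exact: sqr_ge0.
  by rewrite exprn_even_gt0.
rewrite /enorm ltr_sqrt// (bigD1 i)//= [ltRHS](bigD1 i)//=.
by rewrite ltr_leD// ler_sum.
Qed.

(** [rho] is a choice made by [get], so its value is known only through uniqueness: 1 qualifies, and
    a chosen [r] on either side of 1 contradicts [enorm_dil_lt], applied to [dil beta r^-1 s] or to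
    [s]. *)
Lemma rho_eq1 (s : 'rV[R]_d) : enorm s = 1 -> rho beta s = 1.
Proof.
move=> s1; rewrite /rho; case: eqVneq => [s0|s0].
  move: s1; rewrite s0 /enorm big1 ?sqrtr0; last first.
    by move=> i _; rewrite mxE expr0n.
  by move=> /esym/eqP; rewrite oner_eq0.
have ex : [set r | 0 < r /\ enorm (dil beta r^-1 s) = 1] 1.
  by split => //; rewrite invr1 dil1.
have [r0 rs] := getPex (ex_intro _ _ ex).
set r := get _ in r0 rs *; case: (ltgtP r 1) => // r1; exfalso.
- have t0 : dil beta r^-1 s != 0.
    apply: contra_eq_neq rs => ->; rewrite /enorm big1 ?sqrtr0 1?eq_sym ?oner_eq0//.
    by move=> i _; rewrite mxE expr0n.
  by have := enorm_dil_lt r0 r1 t0; rewrite dilVK// rs s1 ltxx.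
- have r0' : 0 < r^-1 by rewrite invr_gt0.
  have r1' : r^-1 < 1 by rewrite invf_lt1.
  by have := enorm_dil_lt r0' r1' s0; rewrite rs s1 ltxx.
Qed.

(** Intermediate value theorem for the squared norm [h] along the orbit of [t], with [u = expR x] so
    that the parameter runs over the whole line. *)
Lemma enorm_dil_eq1 (t : 'rV[R]_d) : t != 0 ->
  exists2 u, 0 < u & enorm (dil beta u t) = 1.
Proof.
move=> t0; pose h x := \sum_i (expR (beta 0 i * x) * t 0 i) ^+ 2.
have hE x : enorm (dil beta (expR x) t) = Num.sqrt (h x).
  rewrite /enorm /h; congr Num.sqrt; apply: eq_bigr => i _.
  by rewrite mxE /powR gt_eqF ?expR_gt0// expRK.
have ch : continuous h.
  move=> x; apply: cvg_big => [|i _]; first exact: add_continuous.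
  apply: (@continuous_comp _ _ _ (fun x => expR (beta 0 i * x) * t 0 i)
    (fun y : R => y ^+ 2)); last exact: exprn_continuous.
  apply: cvgMr_tmp; apply: (@continuous_comp _ _ _ (fun x => beta 0 i * x) expR).
    exact: mulrl_continuous.
  exact: continuous_expR.
have [i ti0] : exists i, t 0 i != 0.
  apply/existsP; apply: contraNT t0 => /existsPn t0.
  by apply/eqP/rowP => i; rewrite mxE; apply/eqP; rewrite -[_ == _]negbK t0.
pose T := \sum_i t 0 i ^+ 2.
have T0 : 0 < T.
  rewrite /T (bigD1 i)//= ltr_pwDl ?sumr_ge0//; last by move=> *; exact: sqr_ge0.
  by rewrite exprn_even_gt0.
(* At [x1] the [i]-th coordinate is dilated to absolute value 1. *)
pose x1 := - ln `|t 0 i| / beta 0 i.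
have h1 : 1 <= h x1.
  rewrite /h (bigD1 i)//= -[leLHS]addr0 lerD ?sumr_ge0//; last first.
    by move=> *; exact: sqr_ge0.
  rewrite /x1 [beta 0 i * _]mulrC mulfVK ?gt_eqF// expRN lnK ?posrE ?normr_gt0//.
  by rewrite exprMn exprVn real_normK ?num_real// mulVf// sqrf_eq0.
(* Chosen so that [expR (2 * beta_j * x0) <= T^-1] for every [j] at once; the sum of nonnegative
   terms stands in for their maximum. *)
pose x0 := - \sum_i `|ln T| / (2 * beta 0 i).
have h0 : h x0 <= 1.
  rewrite -(mulVf (lt0r_neq0 T0)) /h {2}/T mulr_sumr ler_sum// => j _.
  rewrite exprMn ler_wpM2r ?sqr_ge0// -[leRHS]lnK ?posrE ?invr_gt0//.
  rewrite -expRM_natl ler_expR lnV ?posrE// mulrA.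
  rewrite (@le_trans _ _ (- `|ln T|))//; last by rewrite lerN2 ler_norm.
  rewrite /x0 mulrN lerN2 (bigD1 j)//= mulrDr [2 * _ * (_ / _)]mulrC mulfVK; last first.
    by rewrite mulf_neq0// gt_eqF.
  rewrite lerDl mulr_ge0 ?sumr_ge0//.
    by rewrite mulr_ge0// ltW.
  by move=> k _; rewrite divr_ge0// mulr_ge0// ltW.
(* The order of [x0] and [x1] is left open, so the intermediate value theorem is applied on
   whichever interval they span. *)
have [le01|lt10] := leP x0 x1.
  have [|x _ hx] := @IVT R h x0 x1 1 le01 (continuous_subspaceT ch).
    by rewrite ge_min le_max h0 h1 orbT.
  by exists (expR x); rewrite ?expR_gt0// hE hx sqrtr1.
have [|x _ hx] := @IVT R h x1 x0 1 (ltW lt10) (continuous_subspaceT ch).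
  by rewrite ge_min le_max h0 h1 orbT.
by exists (expR x); rewrite ?expR_gt0// hE hx sqrtr1.
Qed.

Definition homogeneous_between (gl gu : R) (G : 'rV[R]_d -> R) :=
  [/\ forall t, 0 <= G t,
      forall t u, 0 < u -> G (dil beta u t) = u * G t &
      forall t, rho beta t = 1 -> gl <= G t <= gu].

(** The witness is the quasi-norm of [t], obtained as the inverse of the factor [u] that dilates [t]
    to the unit sphere. Homogeneity carries the lower bound of [G] back from the sphere, where every
    coordinate is at most 1 in absolute value. At the origin the witness is 0. *)
Lemma homogeneous_lower (gl gu : R) (G : 'rV[R]_d -> R) t :
  homogeneous_between gl gu G ->
  exists r, [/\ 0 <= r, gl * r <= G t & forall i, `|t 0 i| <= r `^ beta 0 i].
Proof.
move=> [G0 Gh Gb]; have [->|t0] := eqVneq t 0.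
  by exists 0; split=> // [|i]; rewrite ?mulr0// mxE normr0 powR_ge0.
have [u u0 ut] := enorm_dil_eq1 t0.
have uV0 : 0 < u^-1 by rewrite invr_gt0.
exists u^-1; split=> [||i]; first exact: ltW.
  rewrite -[in leRHS](dilK u0 t) Gh// mulrC ler_wpM2l ?(ltW uV0)//.
  by have /andP[] := Gb _ (rho_eq1 ut).
have le1 : `|dil beta u t 0 i| <= 1.
  rewrite -ut /enorm -sqrtr_sqr ler_wsqrtr// (bigD1 i)//= lerDl sumr_ge0//.
  by move=> *; exact: sqr_ge0.
move: le1; rewrite mxE normrM ger0_norm ?powR_ge0//.
have ub : 0 < u `^ beta 0 i by rewrite powR_gt0.
by rewrite powRV// mulrC -[_^-1]mul1r ler_pdivlMr.
Qed.

(** If the [r] of [homogeneous_lower] were 0, every coordinate would be bounded by [0 ^ beta_i],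
    which is 0 since [beta_i] is nonzero. *)
Lemma homogeneous_gt0 (gl gu : R) (G : 'rV[R]_d -> R) t : 0 < gl ->
  homogeneous_between gl gu G -> t != 0 -> 0 < G t.
Proof.
move=> gl0 /homogeneous_lower-/(_ t)[r [r0 Gr tr]] t0.
apply: lt_le_trans Gr; rewrite mulr_gt0// lt_neqAle r0 andbT.
apply: contraNneq t0 => r0'; apply/eqP/rowP => i; rewrite mxE; apply/eqP.
have := tr i; rewrite -r0' powR0; last by rewrite gt_eqF.
by rewrite normr_le0.
Qed.

End quasinorm.

(** * Uniform bounds for integrals of exponentials of homogeneous functions *)

Section integral_bound.
Variable R : realType.
Local Open Scope ereal_scope.

Definition cube d : set 'rV[R]_d := [set t | forall i, (`|t 0 i| <= 1)%R].

Lemma measurable_cube d : measurable (@cube d : set (Borel 'rV[R]_d)).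
Proof.
rewrite (_ : @cube d = \bigcap_(i in [set: 'I_d])
    ((fun t : Borel 'rV[R]_d => t 0%R i) @^-1` `[(-1)%R, 1%R])); last first.
  apply/seteqP; split => t /= h i; last by have /= := h i I; rewrite in_itv/= ler_norml.
  by move=> _ /=; rewrite in_itv/= -ler_norml; exact: h.
apply: fin_bigcap_measurable => // i _; rewrite -[X in measurable X]setTI.
have : measurable_fun setT (fun t : Borel 'rV[R]_d => t 0%R i).
  by apply: continuous_measurable_Borel; exact: coord_continuous.
by apply => //; exact: measurable_itv.
Qed.

(** Induction on the dimension: the slice at [x] is the lower-dimensional cube when [x] lies in
    [[-1, 1]] and is empty otherwise. *)
Lemma lebesgue_cube_lty d : lebesgue_rV (@cube d) < +oo.
Proof.
elim: d => [|d IH] /=; first exact: ltry.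
rewrite (_ : (fun x => _) =
    ((fun _ : R => lebesgue_rV (@cube d)) \_ `[(-1)%R, 1%R])); last first.
  apply/funext => x; rewrite patchE; case: ifPn => [|/negP];
      rewrite inE/= in_itv/= => x1.
    congr lebesgue_rV; apply/seteqP; split => v /= h i.
      by have := h (rshift 1 i); rewrite (@row_mxEr _ 1 1 d).
    rewrite -(@splitK 1 d i); case: fintype.split => j /=; last first.
      by rewrite (@row_mxEr _ 1 1 d).
    by rewrite (@row_mxEl _ 1 1 d) !ord1 mxE eqxx mulr1n ler_norml.
  rewrite (_ : mkset _ = set0) ?measure0//.
  apply/seteqP; split => v //= h; apply: x1.
  have := h (@lshift 1 d ord0).
  by rewrite (@row_mxEl _ 1 1 d) !mxE eqxx mulr1n ler_norml.
rewrite -integral_mkcond integral_cst//= lebesgue_measure_itv/= lte_fin.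
rewrite ifT; last by lra.
by rewrite -EFinB lte_mul_pinfty ?ltry// ge0_fin_numE.
Qed.

Lemma measurable_rV_set10 d : measurable ([set 0%R] : set (Borel 'rV[R]_d)).
Proof.
have c0 : closed ([set 0%R] : set 'rV[R]_d).
  exact/accessible_closed_set1/hausdorff_accessible/norm_hausdorff.
rewrite -[X in measurable X]setCK; apply: measurableC.
by apply: sub_sigma_algebra; exact: closed_openC.
Qed.

Context (d : nat) (beta : 'rV[R]_d).
Hypothesis beta_gt0 : forall i, (0 < beta 0%R i)%R.
Let Q := (\sum_i beta 0 i)%R.
Notation leb := (@lebesgue_rV R d).

(* A dilation fixes the origin but multiplies its finite measure by a factor
   different from 1. *)
Lemma lebesgue_rV_set10 : (0 < d)%N -> leb [set 0%R] = 0.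
Proof.
move=> d0; have Q0 : (0 < Q)%R.
  rewrite /Q (bigD1 (Ordinal d0))//= ltr_pwDl// sumr_ge0// => i _.
  exact: ltW.
have m0 := @measurable_rV_set10 d.
have := lebesgue_rV_dil beta (@ltr0Sn R 1) m0.
rewrite (_ : dil beta 2 @^-1` _ = [set 0%R]); last first.
  apply/seteqP; split => t /=; last first.
    by move=> ->; apply/rowP => i; rewrite !mxE mulr0.
  move=> t0; apply/rowP => i; move/rowP: t0 => /(_ i).
  rewrite !mxE => /eqP; rewrite mulf_eq0 gt_eqF ?powR_gt0//= => /eqP->//.
have : leb [set 0%R] \is a fin_num.
  rewrite ge0_fin_numE ?measure_ge0//.
  apply: le_lt_trans (lebesgue_cube_lty d); apply: le_measure; rewrite ?inE//.
    exact: measurable_cube.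
  by move=> _ -> i /=; rewrite mxE normr0.
move=> /fineK <-; rewrite -EFinM => -[] e; congr _%:E.
have lt1 : (2 `^ (- Q) < 1 :> R)%R.
  rewrite powRN invf_lt1 ?powR_gt0// /powR gt_eqF// -[ltLHS]expR0 ltr_expR.
  by rewrite mulr_gt0// ln_gt0// ltr1n.
move/eqP: e; rewrite -subr_eq0 -{1}[fine _]mul1r -mulrBl mulf_eq0 subr_eq0.
by rewrite gt_eqF//= => /eqP.
Qed.

Lemma ge0_integral_dil u (h : 'rV[R]_d -> \bar R) : (0 < u)%R ->
  measurable_fun setT (h : Borel 'rV[R]_d -> \bar R) -> (forall t, 0 <= h t) ->
  \int[leb]_t h (dil beta u t) = (u `^ (- Q))%:E * \int[leb]_t h t.
Proof.
move=> u0 mh h0.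
apply: (ge0_integral_comp_scale (k := NngNum (powR_ge0 u (- Q)))) => //.
  exact: measurable_dil.
by move=> A mA; rewrite /= lebesgue_rV_dil.
Qed.

Lemma integral_dil u (h : 'rV[R]_d -> \bar R) : (0 < u)%R ->
  leb.-integrable setT (h : Borel 'rV[R]_d -> \bar R) ->
  \int[leb]_t h (dil beta u t) = (u `^ (- Q))%:E * \int[leb]_t h t.
Proof.
move=> u0 ih; have mh := measurable_int _ ih.
rewrite [LHS]integralE [X in _ * X]integralE muleBr//; last first.
  rewrite fin_num_adde_defl// fin_numN.
  exact: integrable_neg_fin_num.
have mp := measurable_funepos mh; have mn := measurable_funeneg mh.
rewrite -(@ge0_integral_dil _ (h^\+))// -(@ge0_integral_dil _ (h^\-))//.
by congr (_ - _); apply: eq_integral => t _; rewrite ?funeposE ?funenegE.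
Qed.

Lemma powR_le_expR (q e : R) : (0 < q)%R -> (0 < e)%R ->
  exists C : R, forall k : nat, (k.+1%:R `^ q <= C * expR (e * k%:R))%R.
Proof.
move=> q0 e0; have eq0 : (0 < e / q)%R by rewrite divr_gt0.
(* The constant comes from [ln (1 + x) <= x] at [x = (e / q) * (k + 1) - 1], multiplied by [q]. *)
exists (expR (e - q - q * ln (e / q))) => k.
have k0 : (0 < k.+1%:R :> R)%R by [].
rewrite /powR gt_eqF// -expRD ler_expR.
have := @le_ln1Dx R (e / q * k.+1%:R - 1).
rewrite ltrBrDl subrr addrC subrK => /(_ (mulr_gt0 eq0 k0)).
rewrite lnM ?posrE//; set L := ln k.+1%:R => hL.
have : (q * (ln (e / q) + L) <= q * (e / q * k.+1%:R - 1))%R by rewrite ler_pM2l.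
rewrite mulrDr mulrBr mulr1 !mulrA [(q * e)%R]mulrC mulfK ?gt_eqF//.
by rewrite -natr1 mulrDr mulr1; lra.
Qed.

(* On the shell [k <= r < k + 1] of [homogeneous_lower] the integrand is at most
   [expR (- delta * gl * k)], and the shell lies in the cube dilated by [k + 1]. *)
Lemma integral_exp_homogeneous_bound (gl delta : R) :
  (0 < gl)%R -> (0 < delta)%R ->
  exists K : R, forall gu (G : 'rV[R]_d -> R), homogeneous_between beta gl gu G ->
    measurable_fun setT (G : Borel 'rV[R]_d -> R) ->
    \int[leb]_t (expR (- delta * G t))%:E <= K%:E.
Proof.
move=> gl0 de0; pose e := (delta * gl)%R.
have e0 : (0 < e)%R by rewrite mulr_gt0.
pose E (k : nat) : set (Borel 'rV[R]_d) := dil beta k.+1%:R^-1 @^-1` @cube d.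
pose w (k : nat) (t : Borel 'rV[R]_d) : \bar R :=
  (expR (- e * k%:R) * \1_(E k) t)%:E.
have mE k : measurable (E k).
  rewrite -[E k]setTI; apply: measurable_dil => //; exact: measurable_cube.
have mw k : measurable_fun setT (w k).
  by apply/measurable_EFinP; apply: measurable_funM => //; exact: measurable_indic.
have w0 k t : 0 <= w k t by rewrite lee_fin mulr_ge0// expR_ge0.
(* Half of the decay rate [e] is spent on [(k + 1) ^ Q], the growth of the volume of the dilated
   cubes; the other half leaves a geometric series. The case [Q <= 0] occurs only for [d = 0]. *)
have [C hC] : exists C : R, forall k, (k.+1%:R `^ Q <= C * expR (e / 2 * k%:R))%R.
  have [Q0|Q0] := ltP 0%R Q; first by apply: powR_le_expR => //; rewrite divr_gt0.
  exists 1%R => k; rewrite mul1r (@le_trans _ _ 1%R)//.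
    by rewrite -[leRHS](powRr0 k.+1%:R) ler_powR// ler1n.
  by rewrite -expR0 ler_expR mulr_ge0// divr_ge0// ltW.
have C0 : (0 <= C)%R.
  by have := hC 0%N; rewrite powR1 mulr0 expR0 mulr1; apply: le_trans.
pose V := fine (lebesgue_rV (@cube d)).
have VE : lebesgue_rV (@cube d) = V%:E.
  by rewrite fineK// ge0_fin_numE ?measure_ge0// lebesgue_cube_lty.
have V0 : (0 <= V)%R by rewrite -lee_fin -VE measure_ge0.
have intw k : \int[leb]_t w k t <= (geometric (C * V) (expR (- (e / 2))) k)%:E.
  rewrite /w; under eq_integral do rewrite EFinM.
  rewrite ge0_integralZl//; last first.
    by apply/measurable_EFinP; exact: measurable_indic.
  rewrite integral_indic// setIT.
  rewrite [X in _ * X](lebesgue_rV_dil beta _ (@measurable_cube d)) ?invr_gt0//.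
  rewrite VE -!EFinM lee_fin /geometric/= -expRM_natr mulrA [leRHS]mulrAC ler_wpM2r//.
  rewrite powRV// powRN invrK.
  apply: le_trans (ler_wpM2l (expR_ge0 _) (hC k)) _.
  rewrite mulrCA -expRD -mulrDl ler_wpM2l// ler_expR ler_wpM2r//; lra.
(* The sum of the geometric series. It is fixed before [G] is introduced and depends on it only
   through [gl], which later makes the bound uniform over the fibres. *)
exists (C * V / (1 - expR (- (e / 2))))%R => gu G hG mG.
have leW t : (expR (- delta * G t))%:E <= \sum_(k <oo) w k t.
  have [r [r0 Gr tr]] := homogeneous_lower beta_gt0 t hG.
  pose k := Num.trunc r.
  have /andP[kr rk] : (k%:R <= r < k.+1%:R)%R by exact: truncn_itv.
  apply: (@le_trans _ _ (w k t)).
    rewrite /w lee_fin indicE mem_set ?mulr1.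
      rewrite ler_expR !mulNr lerN2 /e -mulrA ler_pM2l//.
      by rewrite (le_trans _ Gr)// ler_pM2l.
    move=> i; rewrite mxE normrM ger0_norm ?powR_ge0//.
    rewrite powRV// mulrC ler_pdivrMr ?powR_gt0// mul1r (le_trans (tr i))//.
    by rewrite ge0_ler_powR// ?nnegrE// ltW.
  apply: le_trans (nneseries_lim_ge k.+1 _) => //.
  by rewrite big_nat_recr//= leeDr// sume_ge0.
apply: (@le_trans _ _ (\int[leb]_t \sum_(k <oo) w k t)).
  apply: ge0_le_integral => //.
  - apply/measurable_EFinP; apply: measurableT_comp => //.
    exact: measurable_funM.
  - exact: ge0_emeasurable_sum.
rewrite integral_nneseries//.
apply: le_trans (lee_nneseries _ (fun k _ => intw k)) _.
  by move=> k _ _; apply: integral_ge0 => t _; exact: w0.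
set c := (C * V)%R; set q := expR (- (e / 2)).
have q1 : (`|q| < 1)%R.
  by rewrite ger0_norm ?expR_ge0// -expR0 ltr_expR oppr_lt0 divr_gt0.
rewrite (_ : \sum_(k <oo) _ = (c / (1 - q))%:E)//.
apply/cvg_lim => //; rewrite (_ : (fun n => _) = EFin \o series (geometric c q)).
  by apply: cvg_EFin; [exact: nearW|exact: cvg_geometric_series].
by apply/funext => n /=; rewrite sumEFin.
Qed.

End integral_bound.

(** * Measurability of sections and parameter integrals, and limits along sequences *)

(** Extension by zero outside [D] turns the integral into a difference of two Tonelli integrals of
    nonnegative functions. The identity is that of the definition of the integral, so it also holds
    at parameters where the section is not integrable. *)
Lemma measurable_Rintegral_section d1 d2 (T : measurableType d1)
    (X : measurableType d2) (R : realType)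
    (m : {sigma_finite_measure set X -> \bar R}) (D : set (T * X))
    (h : T * X -> R) :
  measurable D -> measurable_fun D h ->
  measurable_fun setT
    (fun p => Rintegral m [set s | D (p, s)] (fun s => h (p, s))).
Proof.
move=> mD mh; pose H := (EFin \o h) \_ D.
have mH : measurable_fun setT H.
  by apply/(measurable_restrictT _ mD)/measurable_EFinP.
rewrite (_ : (fun p => _) =
    (fun p => fine (fubini_F m H^\+ p - fubini_F m H^\- p)%E)).
  apply: measurableT_comp; first exact: fine_measurable.
  apply: emeasurable_funB.
    by apply: measurable_fun_fubini_tonelli_F => //; exact: measurable_funepos.
  by apply: measurable_fun_fubini_tonelli_F => //; exact: measurable_funeneg.
apply/funext => p; rewrite /Rintegral integral_mkcond integralE.
congr (fine (_ - _)%E); apply: eq_integral => s _.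
  by rewrite !funeposE; congr (maxe _ _); rewrite /H !patchE.
by rewrite !funenegE; congr (maxe (- _)%E _); rewrite /H !patchE.
Qed.

Lemma measurable_fun_section d1 d2 d3 (T : measurableType d1)
    (X : measurableType d2) (Y : measurableType d3) (D : set (T * X))
    (h : T * X -> Y) p :
  measurable D -> measurable_fun D h ->
  measurable_fun [set s | D (p, s)] (fun s => h (p, s)).
Proof.
move=> mD mh _ V mV; have := measurable_xsection p (mh mD V mV).
by congr measurable; apply/seteqP; split=> s; rewrite /xsection/= inE.
Qed.

(** Dominated convergence works along sequences and the estimates need [z > 0]; a sequence tending
    to infinity eventually equals its maximum with 1. *)
Lemma cvg_pinfty_pos (R : realType) (f : R -> R) (l : R) :
  (forall z : nat -> R, (forall n, 0 < z n) ->
    z n @[n --> \oo] --> +oo -> f (z n) @[n --> \oo] --> l) ->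
  f z @[z --> +oo] --> l.
Proof.
move=> fl; apply/cvg_pinftyP => u uoo; pose z n := Num.max (u n) 1.
have z0 n : 0 < z n by rewrite lt_max ltr01 orbT.
have zoo : z n @[n --> \oo] --> +oo.
  apply/cvgryPge => M; move/cvgryPge : uoo => /(_ M).
  by apply: filterS => n un; rewrite /z le_max un.
apply: cvg_trans (fl z z0 zoo); apply: near_eq_cvg.
move/cvgryPge : uoo => /(_ 1); apply: filterS => n un.
by rewrite /z max_l.
Qed.

(** * The integral over one cell *)

Section fiber.
Context (R : realType) (d : nat) (beta : 'rV[R]_d).
Hypothesis beta_gt0 : forall i, 0 < beta 0 i.
Let Q := \sum_i beta 0 i.
Notation X := (Borel 'rV[R]_d).
Let leb : {measure set X -> \bar R} := @lebesgue_rV R d.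

Context (gl gu : R) (G : 'rV[R]_d -> R).
Hypotheses (gl_gt0 : 0 < gl) (hG : homogeneous_between beta gl gu G)
  (mG : measurable_fun setT (G : X -> R)).

Lemma measurable_exp_homogeneous (delta : R) :
  measurable_fun setT (fun t : X => expR (- delta * G t)).
Proof. by apply: measurableT_comp => //; exact: measurable_funM. Qed.

Lemma integrable_exp_homogeneous (delta : R) : 0 < delta ->
  leb.-integrable setT (fun t => (expR (- delta * G t))%:E).
Proof.
move=> de0; have [K hK] := integral_exp_homogeneous_bound beta_gt0 gl_gt0 de0.
apply/integrableP; split.
  by apply/measurable_EFinP; exact: measurable_exp_homogeneous.
under eq_integral do rewrite gee0_abs ?lee_fin ?expR_ge0//.
exact: le_lt_trans (hK _ _ hG mG) (ltry _).
Qed.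

Context (A : set X) (b psi : 'rV[R]_d -> R) (c B kappa : R).
Hypotheses (mA : measurable A) (mb : measurable_fun A b)
  (mpsi : measurable_fun A psi) (c_gt0 : 0 < c) (B_ge0 : 0 <= B)
  (kappa_gt0 : 0 < kappa) (bB : forall s, A s -> `|b s| <= B)
  (psi_ge : forall s, A s -> kappa * G s <= psi s / c).

(** On one fibre [psi] plays the role of [f] along the cell minus its minimum, so that [psi / c] is
    the phase [phi]; [b] is the real or imaginary part of the amplitude. Then [k] is the inner
    integrand with [expR (- z * f0)] divided out. *)
Let k z s := b s * expR (- z * psi s).

Let measurable_k z : measurable_fun A (k z : X -> R).
Proof.
apply: measurable_funM => //; apply: measurableT_comp => //.
exact: measurable_funM.
Qed.

Let k_le z s : 0 < z -> A s -> `|k z s| <= B * expR (- (z * c * kappa) * G s).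
Proof.
move=> z0 As; rewrite normrM ler_pM ?bB// ger0_norm ?expR_ge0// ler_expR.
rewrite !mulNr lerN2 -!mulrA ler_pM2l// -ler_pdivlMl//.
by rewrite [leRHS]mulrC; exact: psi_ge.
Qed.

Lemma fiber_integrable z : 0 < z -> leb.-integrable A (EFin \o k z).
Proof.
move=> z0; have zck : 0 < z * c * kappa by rewrite !mulr_gt0.
apply: (@le_integrable _ _ _ leb _ mA _
  (fun s => B%:E * (expR (- (z * c * kappa) * G s))%:E)%E).
- by apply/measurable_EFinP; exact: measurable_k.
- move=> s As; rewrite -EFinM !abse_EFin lee_fin (le_trans (k_le z0 As))//.
  exact: ler_norm.
- apply: integrableZl => //.
  by apply: integrableS (integrable_exp_homogeneous zck).
Qed.

(* The integrand in the variable [t] with [s = dil beta (z * c)^-1 t]. *)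
Let h z t := (k z \_ A) (dil beta (z * c)^-1 t).

Let measurable_h z : measurable_fun setT (h z : X -> R).
Proof.
apply: (@measurableT_comp _ _ _ _ _ _ (k z \_ A : X -> R)).
  by apply/(measurable_restrictT _ mA); exact: measurable_k.
exact: measurable_dil.
Qed.

(** The bound [k_le] at the dilated point: homogeneity of [G] absorbs the factor [z * c], so the
    majorant no longer depends on [z] or [c]. *)
Let h_le z t : 0 < z -> `|h z t| <= B * expR (- kappa * G t).
Proof.
move=> z0; have zc0 : 0 < z * c by rewrite mulr_gt0.
rewrite /h patchE; case: ifPn => [|_]; last first.
  by rewrite normr0 mulr_ge0// expR_ge0.
rewrite inE => As; apply: le_trans (k_le z0 As) _.
have [_ Gh _] := hG; rewrite Gh ?invr_gt0//.
by rewrite mulrA mulNr mulrAC mulfV ?mul1r// gt_eqF.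
Qed.

Let integrable_h z : 0 < z -> leb.-integrable setT (EFin \o h z).
Proof.
move=> z0; apply: (@le_integrable _ _ _ leb _ measurableT _
  (fun s => B%:E * (expR (- kappa * G s))%:E)%E).
- by apply/measurable_EFinP; exact: measurable_h.
- move=> s _; rewrite -EFinM !abse_EFin lee_fin (le_trans (h_le _ z0))//.
  exact: ler_norm.
- exact: integrableZl (integrable_exp_homogeneous kappa_gt0).
Qed.

(** Composition with the dilation by [(z * c)^-1] multiplies integrals by [((z * c)^-1) ^ (- Q)],
    which is [(z * c) ^ Q]. *)
Lemma fiber_rescale z : 0 < z ->
  (z * c) `^ Q * Rintegral leb A (k z) = Rintegral leb setT (h z).
Proof.
move=> z0; have zc0 : 0 < z * c by rewrite mulr_gt0.
have iH : leb.-integrable setT ((EFin \o k z) \_ A).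
  by apply/(integrable_mkcond _ mA); exact: fiber_integrable.
have uV : (z * c)^-1 `^ (- Q) = (z * c) `^ Q by rewrite powRV// powRN invrK.
have V0 : 0 < (z * c)^-1 by rewrite invr_gt0.
rewrite /Rintegral [in LHS]integral_mkcond.
have -> : (\int[leb]_t (h z t)%:E = \int[leb]_t ((EFin \o k z) \_ A)
    (dil beta (z * c)^-1 t))%E.
  by apply: eq_integral => t _; rewrite /h !patchE; case: ifP.
by rewrite (integral_dil beta V0 iH) uV fineM// integrable_fin_num.
Qed.

Lemma le_Rintegral_exp (g : 'rV[R]_d -> R) (C delta K : R) : 0 < delta ->
  measurable_fun setT (g : X -> R) -> 0 <= C ->
  (forall t, `|g t| <= C * expR (- delta * G t)) ->
  (\int[leb]_t (expR (- delta * G t))%:E <= K%:E)%E ->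
  `|Rintegral leb setT g| <= C * K.
Proof.
move=> de0 mg C0 gC hK.
have mE : measurable_fun setT (fun t : X => (expR (- delta * G t))%:E).
  by apply/measurable_EFinP; exact: measurable_exp_homogeneous.
have ig : leb.-integrable setT (EFin \o g).
  apply: (@le_integrable _ _ _ leb _ measurableT _
    (fun s => C%:E * (expR (- delta * G s))%:E)%E).
  - exact/measurable_EFinP.
  - move=> s _; rewrite -EFinM !abse_EFin lee_fin (le_trans (gC s))//.
    exact: ler_norm.
  - exact: integrableZl (integrable_exp_homogeneous de0).
apply: le_trans (le_normr_Rintegral _ ig) _ => //.
rewrite -lee_fin /Rintegral fineK; last first.
  apply: integrable_fin_num => //.
  exact: integrable_norm.
apply: (@le_trans _ _ (\int[leb]_t (C%:E * (expR (- delta * G t))%:E))%E).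
  apply: ge0_le_integral => //.
  - by apply/measurable_EFinP; exact: measurableT_comp.
  - exact: measurable_funeM.
  - by move=> t _; rewrite -EFinM lee_fin.
rewrite ge0_integralZl//.
by rewrite EFinM lee_wpmul2l// lee_fin.
Qed.

(** [K] bounds an integral that involves neither [z] nor the cell, so this supplies the majorant for
    dominated convergence over the base. *)
Lemma fiber_bound z K : 0 < z ->
  (\int[leb]_t (expR (- kappa * G t))%:E <= K%:E)%E ->
  (z * c) `^ Q * `|Rintegral leb A (k z)| <= B * K.
Proof.
move=> z0; rewrite -[X in X * _](ger0_norm (powR_ge0 _ _)) -normrM.
rewrite fiber_rescale//; apply: le_Rintegral_exp => //.
by move=> t; exact: h_le.
Qed.

Context (b0 gamma : R) (Ainf : set X).
Hypotheses (mAinf : measurable Ainf) (b0B : `|b0| <= B) (gamma_gt0 : 0 < gamma)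
  (gamma_le : gamma <= Num.min 1 kappa) (d_gt0 : (0 < d)%N)
  (b_cvg : b s @[s --> within A (0 : 'rV[R]_d)^'] --> b0)
  (psi_cvg : psi s / c / G s @[s --> within A (0 : 'rV[R]_d)^'] --> (1 : R))
  (A_cvg : (\int[leb]_t (`|\1_(dil beta (z * c) @` A) t - \1_Ainf t|
    * expR (- gamma * G t))%:E)%E @[z --> +oo] --> 0%E).

Lemma fiber_integrable_limit :
  leb.-integrable Ainf (fun t => (expR (- G t))%:E).
Proof.
have := integrable_exp_homogeneous ltr01.
under eq_fun do rewrite mulN1r.
by move/integrableS; apply.
Qed.

Let F := (fun t => b0 * expR (- G t)) \_ Ainf.

Let measurable_F : measurable_fun setT (F : X -> R).
Proof.
apply/(measurable_restrictT _ mAinf); apply: measurable_funTS.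
by apply: measurable_funM => //; under eq_fun do rewrite -mulN1r;
  exact: measurable_exp_homogeneous.
Qed.

Let F_le t : `|F t| <= B * expR (- 1 * G t).
Proof.
rewrite /F patchE mulN1r; case: ifPn => _.
  by rewrite normrM ler_pM// ger0_norm// expR_ge0.
by rewrite normr0 mulr_ge0// expR_ge0.
Qed.

Let Rintegral_F :
  b0 * Rintegral leb Ainf (fun t => expR (- G t)) = Rintegral leb setT F.
Proof.
by rewrite /F -Rintegral_mkcond RintegralZl//; exact: fiber_integrable_limit.
Qed.

Lemma fiber_limit_bound K :
  (\int[leb]_t (expR (- 1 * G t))%:E <= K%:E)%E ->
  `|b0 * Rintegral leb Ainf (fun t => expR (- G t))| <= B * K.
Proof. by rewrite Rintegral_F; apply: le_Rintegral_exp. Qed.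

(* Separates the convergence of the integrand ([h - E]) from that of the domain
   ([E - F]). *)
Let E z t := \1_(dil beta (z * c) @` A) t * (b0 * expR (- G t)).

(** The limit is in the punctured neighbourhood filter, as the hypotheses on [b] and [psi] require:
    dilations are invertible, so a nonzero [t] never reaches the origin. The coordinates tend to 0
    because all [beta_i] are positive. *)
Lemma dil_cvg0 (v : nat -> R) (t : 'rV[R]_d) :
  (forall n, 0 < v n) -> v n @[n --> \oo] --> +oo -> t != 0 ->
  dil beta (v n)^-1 t @[n --> \oo] --> (0 : 'rV[R]_d)^'.
Proof.
move=> v0 voo t0.
have t0' n : dil beta (v n)^-1 t != 0.
  apply: contra_neq t0 => vt; rewrite -(dilVK beta (v0 n) t) vt.
  by apply/rowP => i; rewrite !mxE mulr0.
have cv i : dil beta (v n)^-1 t 0 i @[n --> \oo] --> (0 : R).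
  under eq_fun do rewrite mxE.
  have -> : (0 : R) = 0 * t 0 i by rewrite mul0r.
  apply: cvgMr_tmp.
  have vV : (v n)^-1 @[n --> \oo] --> (0 : R)^'+.
    move=> U /= [e /= e0 eU].
    have : (v n)^-1 @[n --> \oo] --> (0 : R) by apply/gtr0_cvgV0 => //; exact: nearW.
    move=> /cvgr0_norm_lt/(_ e e0); apply: filterS => n vn; apply: eU => /=.
      by rewrite sub0r normrN.
    by rewrite invr_gt0.
  exact: cvg_comp vV (powR_cvg0 (beta_gt0 i)).
move=> U /nbhs_ballP[e /= e0 eU].
have h0 i : \forall n \near \oo, `|dil beta (v n)^-1 t 0 i| < e.
  by apply: (cvgr0_norm_lt _ (cv i)).
have [n0 _ hn0] : \forall n \near \oo, forall i, `|dil beta (v n)^-1 t 0 i| < e.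
  exact: filter_forall.
exists n0 => // n /hn0 hn; apply: eU => //.
by split=> // j i; rewrite ord1 /ball/= [(0 : 'rV[R]_d) 0 i]mxE sub0r normrN; exact: hn.
Qed.

(** Both functions carry the indicator of the same dilated cell, so their difference is [1_A * r] at
    the dilated point, and [r] tends to 0 within [A]. Convergence of the domains does not enter at
    this stage. *)
Let hE_cvg (z : nat -> R) t : (forall n, 0 < z n) ->
  z n @[n --> \oo] --> +oo -> t != 0 ->
  h (z n) t - E (z n) t @[n --> \oo] --> (0 : R).
Proof.
move=> z0 zoo t0; have zc0 n : 0 < z n * c by rewrite mulr_gt0.
have zcoo : z n * c @[n --> \oo] --> +oo .
  exact: (@gt0_cvgMly R (z @ \oo) _ c id c_gt0 zoo).
pose r s := b s * expR (- (psi s / c / G s * G t)) - b0 * expR (- G t).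
have r0 : r s @[s --> within A (0 : 'rV[R]_d)^'] --> (0 : R).
  rewrite -(subrr (b0 * expR (- G t))); apply: cvgB; last exact: cvg_cst.
  apply: cvgM => //; apply: (cvg_comp _ expR (G := nbhs (- G t))); last first.
    exact: continuous_expR.
  by apply: cvgN; rewrite -[X in _ --> X]mul1r; apply: cvgMr_tmp.
(* Multiplication by the indicator turns the limit within [A] into a full punctured limit, which can
   be composed with [dil_cvg0]. *)
have rA0 : \1_A s * r s @[s --> (0 : 'rV[R]_d)^'] --> (0 : R).
  apply/cvgr0Pnorm_lt => e e0; move/cvgr0Pnorm_lt : r0 => /(_ e e0).
  rewrite near_withinE; apply: filterS => s As.
  rewrite indicE; case: (boolP (s \in A)) => [|_]; last by rewrite mul0r normr0.
  by rewrite mul1r inE; exact: As.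
have := cvg_comp _ _ (dil_cvg0 zc0 zcoo t0) rA0; apply: cvg_trans.
apply: near_eq_cvg; apply: nearW => n /=.
have [_ Gh _] := hG; have Gt0 := homogeneous_gt0 beta_gt0 gl_gt0 hG t0.
rewrite /h /E image_dil// patchE !indicE /= /r Gh ?invr_gt0//.
have -> : (t \in dil beta (z n * c)^-1 @^-1` A) = (dil beta (z n * c)^-1 t \in A).
  by apply/idP/idP; rewrite !inE.
case: ifPn => _; last by rewrite !mul0r subrr.
(* With [G s = (z * c)^-1 * G t] at the dilated point [s], the exponent [z * psi s] equals
   [(psi s / c / G s) * G t]; the cancellation uses [G t > 0], hence [t != 0]. *)
rewrite !mul1r /k; congr (_ * expR _ - _).
by field; rewrite !gt_eqF.
Qed.

Let integrable_F : leb.-integrable setT (EFin \o F).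
Proof.
apply: (@le_integrable _ _ _ leb _ measurableT _
  (fun s => B%:E * (expR (- 1 * G s))%:E)%E).
- by apply/measurable_EFinP; exact: measurable_F.
- move=> s _; rewrite -EFinM !abse_EFin lee_fin (le_trans (F_le s))//.
  exact: ler_norm.
- exact: integrableZl (integrable_exp_homogeneous ltr01).
Qed.

Let measurable_image z : 0 < z -> measurable (dil beta (z * c) @` A : set X).
Proof.
move=> z0; rewrite image_dil ?mulr_gt0// -[X in measurable X]setTI.
exact: measurable_dil.
Qed.

Let measurable_E z : 0 < z -> measurable_fun setT (E z : X -> R).
Proof.
move=> z0; apply: measurable_funM.
  by apply: measurable_indic; exact: measurable_image.
apply: measurable_funM => //; under eq_fun do rewrite -mulN1r.
exact: measurable_exp_homogeneous.
Qed.

(** The rate [gamma] is at most 1, which serves [E], and at most [kappa], which serves [h]: a single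
    weight dominates both and is the one in the hypothesis on the domains. *)
Let E_le z t : `|E z t| <= B * expR (- gamma * G t).
Proof.
have G0 : 0 <= G t by have [] := hG.
have g1 : gamma <= 1 by move: gamma_le; rewrite le_min => /andP[].
rewrite /E !normrM mulrA; apply: ler_pM => //.
  rewrite indicE; case: (_ \in _); first by rewrite normr1 mul1r.
  by rewrite normr0 mul0r.
by rewrite ger0_norm ?expR_ge0// ler_expR mulNr lerN2 ler_piMl.
Qed.

Let h_le_gamma z t : 0 < z -> `|h z t| <= B * expR (- gamma * G t).
Proof.
move=> z0; apply: le_trans (h_le t z0) _; rewrite ler_wpM2l// ler_expR !mulNr lerN2.
have G0 : 0 <= G t by have [] := hG.
by rewrite ler_wpM2r//; move: gamma_le; rewrite le_min => /andP[].
Qed.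

Let eta z := (\int[leb]_t (`|\1_(dil beta (z * c) @` A) t - \1_Ainf t|
    * expR (- gamma * G t))%:E)%E.

(** Triangle inequality through [E]: the difference [E - F] is the difference of the two indicators
    times [b0 * expR (- G t)], whose absolute value is at most [B * expR (- gamma * G t)] since
    [gamma <= 1]. *)
Let Rintegral_le_eta z : 0 < z ->
  (`|Rintegral leb setT (h z) - Rintegral leb setT F|%:E <=
    \int[leb]_t `|(h z t - E z t)%:E - 0| + B%:E * eta z)%E.
Proof.
move=> z0; have mE := measurable_E z0; have mh := measurable_h z.
have mexp := measurable_exp_homogeneous gamma.
have ih := integrable_h z0.
have ihF : leb.-integrable setT (fun t => (h z t - F t)%:E).
  exact: (integrableB _ ih integrable_F).
have m1 : measurable_fun setT (fun t : X =>
    `|\1_(dil beta (z * c) @` A) t - \1_Ainf t| * expR (- gamma * G t)).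
  apply: measurable_funM => //; apply: measurableT_comp => //.
  apply: measurable_funB; apply: measurable_indic => //.
  exact: measurable_image.
rewrite -RintegralB//.
apply: (@le_trans _ _ (\int[leb]_t `|(h z t - F t)%:E|)%E).
  by have := le_abse_integral leb measurableT (measurable_int _ ihF);
    rewrite /Rintegral -abse_EFin fineK// integrable_fin_num.
rewrite /eta -ge0_integralZl//; last by apply/measurable_EFinP.
have mhE : measurable_fun setT (fun t : X => `|(h z t - E z t)%:E - 0|%E).
  under eq_fun do rewrite sube0.
  apply: measurableT_comp => //; apply/measurable_EFinP.
  exact: measurable_funB.
have me0 t : (0 <= B%:E * (`|\1_(dil beta (z * c) @` A) t - \1_Ainf t|
    * expR (- gamma * G t))%:E)%E.
  by rewrite -EFinM lee_fin !mulr_ge0// expR_ge0.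
have mme : measurable_fun setT (fun t : X =>
    B%:E * (`|\1_(dil beta (z * c) @` A) t - \1_Ainf t|
    * expR (- gamma * G t))%:E)%E.
  by apply: measurable_funeM; exact/measurable_EFinP.
rewrite -ge0_integralD//; apply: ge0_le_integral => //.
- by apply: measurableT_comp => //; exact: measurable_int ihF.
- exact: emeasurable_funD.
move=> t _; rewrite sube0 -EFinM !abse_EFin -EFinD lee_fin.
have -> : h z t - F t = (h z t - E z t) + (E z t - F t) by lra.
apply: le_trans (ler_normD _ _) _; rewrite lerD2l.
have -> : E z t - F t =
    (\1_(dil beta (z * c) @` A) t - \1_Ainf t) * (b0 * expR (- G t)).
  rewrite mulrBl; congr (_ - _); rewrite /F patchE indicE.
  by case: ifPn => _; rewrite ?mul1r ?mul0r.
rewrite normrM mulrCA ler_wpM2l// normrM ler_pM// ger0_norm ?expR_ge0//.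
have [G0 _ _] := hG; rewrite ler_expR mulNr lerN2 ler_piMl//.
by move: gamma_le; rewrite le_min => /andP[].
Qed.

Lemma fiber_cvg : (z * c) `^ Q * Rintegral leb A (k z) @[z --> +oo] -->
  b0 * Rintegral leb Ainf (fun t => expR (- G t)).
Proof.
rewrite Rintegral_F.
apply: cvg_pinfty_pos => z z0 zoo.
rewrite (_ : (fun n => _) = fun n => Rintegral leb setT (h (z n))); last first.
  by apply/funext => n; rewrite fiber_rescale.
have [_ dom _] : [/\ leb.-integrable setT (cst 0%E),
    (\int[leb]_t `|(h (z n) t - E (z n) t)%:E - 0|)%E @[n --> \oo] --> 0%E &
    (\int[leb]_t (h (z n) t - E (z n) t)%:E)%E @[n --> \oo] -->
      (\int[leb]_t (cst 0 t))%E].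
  apply: (@dominated_convergence _ _ _ leb setT measurableT
    (fun n t => (h (z n) t - E (z n) t)%:E) (cst 0%E)
    (fun t => ((2 * B)%:E * (expR (- gamma * G t))%:E)%E)).
  - move=> n; apply/measurable_EFinP; apply: measurable_funB => //.
    exact: measurable_E.
  - exact: measurable_cst.
  (* Pointwise convergence is available away from the origin, which is a null set because
     [d >= 1]. *)
  - exists [set 0]; split; first 1 last.
    + exact: lebesgue_rV_set10 beta_gt0 d_gt0.
    + move=> t /= /not_implyP[_]; apply: contra_notP => /eqP t0.
      by apply: cvg_EFin; [exact: nearW|exact: hE_cvg].
    + exact: measurable_rV_set10.
  - exact: integrableZl (integrable_exp_homogeneous gamma_gt0).
  - apply: aeW => t n _; rewrite -EFinM abse_EFin lee_fin.
    apply: le_trans (ler_normB _ _) _.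
    by rewrite -mulrA mulr_natl mulr2n lerD ?E_le ?h_le_gamma.
have etaz : eta (z n) @[n --> \oo] --> 0%E by exact: cvg_comp zoo A_cvg.
apply/subr_cvg0/norm_cvg0P.
have : (\int[leb]_t `|(h (z n) t - E (z n) t)%:E - 0| + B%:E * eta (z n))%E
    @[n --> \oo] --> 0%E.
  by rewrite -[X in _ --> X]add0e; apply: cvgeD => //;
    rewrite -(mule0 B%:E); apply: cvgeZl.
move=> bound0; have : `|Rintegral leb setT (h (z n)) - Rintegral leb setT F|%:E
    @[n --> \oo] --> 0%E.
  apply: squeeze_cvge _ (cvg_cst 0%E) bound0; apply: nearW => n.
  by rewrite lee_fin normr_ge0 Rintegral_le_eta.
by case/fine_cvgP.
Qed.

End fiber.

(** * Integration over the base *)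

Section laplace_integral.
Context dT (T : measurableType dT) (R : realType) (d : nat) (beta : 'rV[R]_d)
  (mu : {measure set T -> \bar R}) (P : set T).
Hypotheses (beta_gt0 : forall i, 0 < beta 0 i) (d_gt0 : (0 < d)%N)
  (mP : measurable P).
Let Q := \sum_i beta 0 i.
Notation X := (Borel 'rV[R]_d).
Let leb : {sigma_finite_measure set X -> \bar R} := @lebesgue_rV R d.

Context (c : T -> R) (G : T -> 'rV[R]_d -> R) (gl gu : R).
Hypotheses (mc : measurable_fun P c) (c_gt0 : forall p, P p -> 0 < c p)
  (gl_gt0 : 0 < gl)
  (hG : forall p, P p -> homogeneous_between beta gl gu (G p))
  (mG : measurable_fun (P `*` setT : set (T * X)) (fun pt => G pt.1 pt.2)).

Context (A Ainf : T -> set X) (b psi : T -> 'rV[R]_d -> R) (b0 B : T -> R)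
  (kappa gamma : R).
Let D : set (T * X) := [set ps | P ps.1 /\ A ps.1 ps.2].
Let Dinf : set (T * X) := [set ps | P ps.1 /\ Ainf ps.1 ps.2].
Hypotheses (mD : measurable D) (mDinf : measurable Dinf)
  (mb : measurable_fun D (fun ps => b ps.1 ps.2))
  (mpsi : measurable_fun D (fun ps => psi ps.1 ps.2))
  (mb0 : measurable_fun P b0)
  (kappa_gt0 : 0 < kappa) (gamma_gt0 : 0 < gamma)
  (gamma_le : gamma <= Num.min 1 kappa)
  (B_ge0 : forall p, P p -> 0 <= B p)
  (bB : forall p s, P p -> A p s -> `|b p s| <= B p)
  (b0B : forall p, P p -> `|b0 p| <= B p)
  (psi_ge : forall p s, P p -> A p s -> kappa * G p s <= psi p s / c p)
  (iB : mu.-integrable P (fun p => (B p * c p `^ (- Q))%:E))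
  (b_cvg : {ae mu, forall p, P p ->
     b p s @[s --> within (A p) (0 : 'rV[R]_d)^'] --> b0 p})
  (psi_cvg : {ae mu, forall p, P p ->
     psi p s / c p / G p s @[s --> within (A p) (0 : 'rV[R]_d)^'] --> (1 : R)})
  (A_cvg : {ae mu, forall p, P p ->
     (\int[leb]_t (`|\1_(dil beta (z * c p) @` A p) t - \1_(Ainf p) t|
       * expR (- gamma * G p t))%:E)%E @[z --> +oo] --> 0%E}).

Let section_eq (E : T -> set X) p : P p ->
  [set s | [set ps : T * X | P ps.1 /\ E ps.1 ps.2] (p, s)] = E p.
Proof. by move=> Pp; apply/seteqP; split=> s /=; [case|]. Qed.

Let measurable_A p : P p -> measurable (A p).
Proof.
move=> Pp; rewrite -(section_eq A Pp); have := measurable_xsection p mD.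
by congr measurable; apply/seteqP; split=> s; rewrite /xsection/= inE.
Qed.

Let measurable_Ainf p : P p -> measurable (Ainf p).
Proof.
move=> Pp; rewrite -(section_eq Ainf Pp); have := measurable_xsection p mDinf.
by congr measurable; apply/seteqP; split=> s; rewrite /xsection/= inE.
Qed.

Let measurable_G p : P p -> measurable_fun setT (G p : X -> R).
Proof.
move=> Pp; have := measurable_fun_section (p := p) (measurableX mP measurableT) mG.
by congr measurable_fun; apply/seteqP; split.
Qed.

Let measurable_b p : P p -> measurable_fun (A p) (b p : X -> R).
Proof.
by move=> Pp; have := measurable_fun_section (p := p) mD mb; rewrite section_eq.
Qed.

Let measurable_psi p : P p -> measurable_fun (A p) (psi p : X -> R).
Proof.
by move=> Pp; have := measurable_fun_section (p := p) mD mpsi; rewrite section_eq.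
Qed.

Let k z p s := b p s * expR (- z * psi p s).
Let J p := Rintegral leb (Ainf p) (fun t => expR (- G p t)).

Lemma laplace_fiber_integrable z p : 0 < z -> P p ->
  leb.-integrable (A p) (EFin \o k z p).
Proof.
move=> z0 Pp.
exact: (fiber_integrable beta_gt0 gl_gt0 (hG Pp) (measurable_G Pp)
  (measurable_A Pp) (measurable_b Pp) (measurable_psi Pp) (c_gt0 Pp) kappa_gt0
  (fun s => @bB p s Pp) (fun s => @psi_ge p s Pp) z0).
Qed.

Lemma laplace_limit_integrable p : P p ->
  leb.-integrable (Ainf p) (fun t => (expR (- G p t))%:E).
Proof.
move=> Pp; apply: (fiber_integrable_limit beta_gt0 gl_gt0 (hG Pp));
  [exact: measurable_G|exact: measurable_Ainf].
Qed.

(** The integral over the section of [D] is measurable in every [p]; the section is [A p] only for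
    [p] in [P], which is why the function is replaced on [P] first. *)
Let measurable_inner z : measurable_fun P (fun p => Rintegral leb (A p) (k z p)).
Proof.
have mk : measurable_fun D (fun ps => k z ps.1 ps.2).
  apply: measurable_funM => //; apply: measurableT_comp => //.
  exact: measurable_funM.
apply: (@eq_measurable_fun _ _ _ _ _
    (fun p => Rintegral leb [set s | D (p, s)] (k z p))).
  by move=> p; rewrite inE => Pp; rewrite section_eq.
apply: measurable_funTS.
exact: (measurable_Rintegral_section leb mD mk).
Qed.

Let measurable_J : measurable_fun P J.
Proof.
have mk : measurable_fun Dinf (fun ps => expR (- G ps.1 ps.2)).
  apply: measurableT_comp => //; apply: measurableT_comp => //.
  by apply: measurable_funS mG => //; [exact: measurableX|move=> ps []].
apply: (@eq_measurable_fun _ _ _ _ _ (fun p =>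
    Rintegral leb [set t | Dinf (p, t)] (fun t => expR (- G p t)))).
  by move=> p; rewrite inE => Pp; rewrite section_eq.
apply: measurable_funTS.
exact: (measurable_Rintegral_section leb mDinf mk).
Qed.

(** Dividing [fiber_bound] by [c p ^ Q] leaves a multiple of the integrable function
    [B * c ^ (- Q)], with the same constant for all [z] and [p]. The absolute value of [K] is taken
    because its sign is not recorded. *)
Let inner_le : exists2 K, 0 <= K & forall z p, 0 < z -> P p ->
  z `^ Q * `|Rintegral leb (A p) (k z p)| <= K * (B p * c p `^ (- Q)).
Proof.
have [K hK] := integral_exp_homogeneous_bound beta_gt0 gl_gt0 kappa_gt0.
exists `|K| => // z p z0 Pp; have cp := c_gt0 Pp.
have cQ : 0 < c p `^ Q by rewrite powR_gt0.
have cp0 := ltW cp; have zp0 := ltW z0.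
rewrite powRN mulrA -ler_pdivrMr ?invr_gt0// invrK mulrAC -powRM//.
apply: (@le_trans _ _ (B p * K)); last first.
  by rewrite mulrC ler_wpM2r ?B_ge0// ler_norm.
apply: (fiber_bound beta_gt0 gl_gt0 (hG Pp) (measurable_G Pp)
  (measurable_A Pp) (measurable_b Pp) (measurable_psi Pp) cp (B_ge0 Pp)
  kappa_gt0 (fun s => @bB p s Pp) (fun s => @psi_ge p s Pp) z0).
exact: hK (hG Pp) (measurable_G Pp).
Qed.

Lemma laplace_inner_integrable z : 0 < z ->
  mu.-integrable P (fun p => (Rintegral leb (A p) (k z p))%:E).
Proof.
move=> z0; have [K K0 hK] := inner_le.
apply: (@le_integrable _ _ _ mu _ mP _
  (fun p => (z `^ (- Q) * K)%:E * (B p * c p `^ (- Q))%:E)%E).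
- by apply/measurable_EFinP.
- move=> p Pp; rewrite -EFinM !abse_EFin lee_fin.
  apply: le_trans (ler_norm _); rewrite -mulrA powRN ler_pdivlMl ?powR_gt0//.
  exact: hK.
- exact: integrableZl.
Qed.

Let limit_le : exists2 K, 0 <= K & forall p, P p ->
  `|c p `^ (- Q) * (b0 p * J p)| <= K * (B p * c p `^ (- Q)).
Proof.
have [K hK] := integral_exp_homogeneous_bound beta_gt0 gl_gt0 (@ltr01 R).
exists `|K| => // p Pp; rewrite normrM ger0_norm ?powR_ge0// mulrC mulrA.
rewrite ler_wpM2r ?powR_ge0//.
apply: (@le_trans _ _ (B p * K)); last first.
  by rewrite mulrC ler_wpM2r ?B_ge0// ler_norm.
apply: (fiber_limit_bound beta_gt0 gl_gt0 (hG Pp));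
  [exact: measurable_G|exact: B_ge0|exact: measurable_Ainf|exact: b0B|].
by apply: hK; [exact: hG|exact: measurable_G].
Qed.

Let measurable_limit : measurable_fun P (fun p => c p `^ (- Q) * (b0 p * J p)).
Proof.
apply: measurable_funM; last exact: measurable_funM.
exact: (measurableT_comp (measurable_powR (- Q)) mc).
Qed.

Lemma laplace_limit_outer_integrable :
  mu.-integrable P (fun p => (c p `^ (- Q) * (b0 p * J p))%:E).
Proof.
have [K K0 hK] := limit_le.
apply: (@le_integrable _ _ _ mu _ mP _
  (fun p => K%:E * (B p * c p `^ (- Q))%:E)%E).
- by apply/measurable_EFinP.
- move=> p Pp; rewrite -EFinM !abse_EFin lee_fin.
  exact: le_trans (hK _ Pp) (ler_norm _).
- exact: integrableZl.
Qed.

Lemma laplace_cvg :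
  z `^ Q * Rintegral mu P (fun p => Rintegral leb (A p) (k z p)) @[z --> +oo]
  --> Rintegral mu P (fun p => c p `^ (- Q) * (b0 p * J p)).
Proof.
apply: cvg_pinfty_pos => z z0 zoo; have [K K0 hK] := inner_le.
have [_ _] : [/\ mu.-integrable P
      (fun p => (c p `^ (- Q) * (b0 p * J p))%:E),
    (\int[mu]_(p in P) `|(z n `^ Q * Rintegral leb (A p) (k (z n) p))%:E -
      (c p `^ (- Q) * (b0 p * J p))%:E|)%E @[n --> \oo] --> 0%E &
    (\int[mu]_(p in P) (z n `^ Q * Rintegral leb (A p) (k (z n) p))%:E)%E
      @[n --> \oo] -->
      (\int[mu]_(p in P) (c p `^ (- Q) * (b0 p * J p))%:E)%E].
  apply: (@dominated_convergence _ _ _ mu P mP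
    (fun n p => (z n `^ Q * Rintegral leb (A p) (k (z n) p))%:E)
    (fun p => (c p `^ (- Q) * (b0 p * J p))%:E)
    (fun p => (K%:E * (B p * c p `^ (- Q))%:E)%E)).
  - move=> n; apply/measurable_EFinP; exact: measurable_funM.
  - exact/measurable_EFinP.
  - apply: filterS3 b_cvg psi_cvg A_cvg => p b_cvgp psi_cvgp A_cvgp Pp.
    have cp := c_gt0 Pp.
    apply: cvg_EFin; first exact: nearW.
    have cv := fiber_cvg beta_gt0 gl_gt0 (hG Pp) (measurable_G Pp)
      (measurable_A Pp) (measurable_b Pp) (measurable_psi Pp) cp (B_ge0 Pp)
      kappa_gt0 (fun s => @bB p s Pp) (fun s => @psi_ge p s Pp)
      (measurable_Ainf Pp) (b0B Pp)
      gamma_gt0 gamma_le d_gt0 (b_cvgp Pp) (psi_cvgp Pp) (A_cvgp Pp).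
    (* Since [(z * c) ^ Q = z ^ Q * c ^ Q], multiplying the fibre limit by [c ^ (- Q)] recovers the
       normalization by [z ^ Q] alone. *)
    rewrite (_ : fine \o _ = fun n => c p `^ (- Q) *
        ((z n * c p) `^ Q * Rintegral leb (A p) (k (z n) p))).
      by apply: cvgMl_tmp; exact: cvg_comp zoo cv.
    apply/funext => n /=; rewrite powRM ?(ltW cp) ?(ltW (z0 n))// powRN.
    by rewrite mulrA mulrCA mulVf ?mulr1// gt_eqF// powR_gt0.
  - exact: integrableZl.
  - apply: aeW => p n Pp; rewrite -EFinM abse_EFin lee_fin.
    by rewrite normrM (ger0_norm (powR_ge0 _ _)) hK.
rewrite -[X in _ --> X -> _]fineK; last first.
  exact: integrable_fin_num laplace_limit_outer_integrable.
move=> /fine_cvg; apply: cvg_trans; apply: near_eq_cvg; apply: nearW => n /=.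
by rewrite -RintegralZl//; exact: laplace_inner_integrable.
Qed.

End laplace_integral.

(** * Normal cells *)

Section cells.
Context (R : realType) (N : ptopologicalType).

(** A relatively open subset of [S] is the trace of an open [W], and [W] is measurable for the
    product sigma-algebra by second countability. It is meant for [cell_map], which is continuous
    only on [cU] times a ball. *)
Lemma measurable_within_continuous (X Y Z : ptopologicalType)
    (S : set (X * Y)) (D : set (Borel X * Borel Y)) (h : X * Y -> Z) :
  @second_countable X -> @second_countable Y -> measurable D -> D `<=` S ->
  {within S, continuous h} ->
  measurable_fun D (h : Borel X * Borel Y -> Borel Z).
Proof.
move=> scX scY mD DS /continuousP ch.
apply: (@measurability _ _ _ (Borel Z) D h (@open Z)) => //.
move=> _ [V oV <-]; have /open_subspaceP[W oW WS] := ch V oV.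
rewrite (_ : D `&` _ = D `&` W).
  by apply: measurableI => //; exact: second_countable_open_prod.
apply/seteqP; split=> x [Dx hx]; split=> //.
  by have [] : (W `&` S) x by rewrite WS; split=> //; exact: DS.
by have [] : (h @^-1` V `&` S) x by rewrite -WS; split=> //; exact: DS.
Qed.

Lemma measurable_eball d (r : R) : measurable (eball r : set (Borel 'rV[R]_d)).
Proof.
have : measurable_fun setT (enorm : Borel 'rV[R]_d -> R).
  apply: (@measurableT_comp _ _ _ _ _ _ (@Num.sqrt R)).
    by apply: continuous_measurable_fun; exact: sqrt_continuous.
  apply: measurable_sum => i; apply: measurable_funX.
  by apply: continuous_measurable_Borel; exact: coord_continuous.
move=> /(_ measurableT _ (measurable_itv `]-oo, r[)); rewrite setTI.
by congr measurable; apply/seteqP; split=> s /=; rewrite in_itv.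
Qed.

Context (n : nat) (g : riemannian R N n) (vol volS : {measure set (Borel N) -> \bar R})
  (S : set N) (eps : R) (K : cell R N n).
Hypothesis hK : is_normal_cell g vol S volS eps K.

Lemma measurable_cell_dom : measurable (cell_dom eps K).
Proof.
have [_ _ _ mA _] := hK.
rewrite (_ : cell_dom eps K = [set ps | cP K ps.1 /\ cA K ps.1 ps.2] `&`
    (setT `*` eball eps)); last first.
  apply/seteqP; split=> -[p s] /=; first by move=> [Pp [As es]].
  by move=> [[Pp As] [_ es]].
apply: measurableI => //; apply: measurableX => //; exact: measurable_eball.
Qed.

Lemma measurable_trunc p : cP K p -> measurable (trunc eps K p).
Proof.
move=> Pp; have := measurable_xsection (p : Borel N) measurable_cell_dom.
congr measurable; apply/seteqP; split=> s; rewrite /xsection/= inE; first by case.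
by [].
Qed.

Lemma measurable_cell_map :
  measurable_fun (cell_dom eps K)
    (cell_map K : Borel N * Borel 'rV[R]_(codim K) -> Borel N).
Proof.
have [_ [_ PU] [[cF _] _] _ _] := hK.
apply: (measurable_within_continuous _ _ measurable_cell_dom _ cF).
- exact: manifold_second_countable g.
- exact: second_countable_rV.
- by move=> [p s] [/= /PU Up [_ es]].
Qed.

End cells.

(** * Real and imaginary parts of complex amplitudes *)

Lemma Re_mul_real (R : realType) (x : R[i]) (r : R) :
  complex.Re (x * r%:C%C) = complex.Re x * r.
Proof. by case: x => u v /=; rewrite mulr0 subr0. Qed.

Lemma Im_mul_real (R : realType) (x : R[i]) (r : R) :
  complex.Im (x * r%:C%C) = complex.Im x * r.
Proof. by case: x => u v /=; rewrite mulr0 add0r. Qed.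

Lemma Re_le_normc (R : realType) (x : R[i]) : `|complex.Re x| <= normc x.
Proof.
by case: x => u v; rewrite /= -sqrtr_sqr ler_wsqrtr// lerDl sqr_ge0.
Qed.

Lemma Im_le_normc (R : realType) (x : R[i]) : `|complex.Im x| <= normc x.
Proof.
by case: x => u v; rewrite /= -sqrtr_sqr ler_wsqrtr// lerDr sqr_ge0.
Qed.

Lemma normc_le_ReIm (R : realType) (x : R[i]) :
  normc x <= `|complex.Re x| + `|complex.Im x|.
Proof.
case: x => u v /=; rewrite -[leRHS]ger0_norm ?addr_ge0// -sqrtr_sqr ler_wsqrtr//.
by rewrite sqrrD !real_normK ?num_real// lerD2r lerDl mulrn_wge0// mulr_ge0.
Qed.

(** * Asymptotics of the complex integral over a cell *)

Theorem theorem3p20 (R : realType) (N : ptopologicalType) (n : nat)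
  (g : riemannian R N n)
  (vol : {measure set (Borel N) -> \bar R})
  (hvol : is_riemannian_volume g n setT vol)
  (f : N -> R) (hf : continuous f) (hf_bounded : has_lbound (range f))
  (a : N -> R[i])
  (ha : cmeasurable_fun (setT : set (Borel N)) a)
  (hM0 : argmin_set f !=set0) (hMc : compact (argmin_set f))
  (l : nat) (Sigma : nat -> set N)
  (hSigma : stratification g (argmin_set f) l Sigma)
  (volS : nat -> {measure set (Borel N) -> \bar R})
  (hvolS : forall j, (j <= l)%N -> is_riemannian_volume g j (Sigma j) (volS j))
  (eps : R) (heps : 0 < eps)
  (I : finType) (K : I -> cell R N n)
  (hK : normal_cell_decomposition g vol l Sigma volS (argmin_set f) eps K)
  (alpha : I) :
  let C := K alpha in
  let d := codim C in
  let P : set (Borel N) := cP C in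
  let F := cF C in
  let A := cA C in
  let volP := volS (cj C) in
  let leb : {measure set (Borel 'rV[R]_d) -> \bar R} := @lebesgue_rV R d in
  let f0 := inf (range f) in
  let b := amplitude a C in
  (1 <= d)%N ->
  forall beta : 'rV[R]_d,
  (forall i, 0 < beta 0 i) ->
  let Q := \sum_i beta 0 i in
  forall c : N -> R,
  measurable_fun P c ->
  (forall p, P p -> 0 < c p) ->
  let phi p s := (f (F p s) - f0) / c p in
  forall G : N -> 'rV[R]_d -> R,
  measurable_fun (P `*` setT : set (Borel N * Borel 'rV[R]_d))
    (fun pt => G pt.1 pt.2) ->
  (forall p t, P p -> 0 <= G p t) ->
  (forall p t u, P p -> 0 < u -> G p (dil beta u t) = u * G p t) ->
  forall g_minus g_plus : R, 0 < g_minus -> g_minus <= g_plus ->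
  (forall p t, P p -> rho beta t = 1 -> g_minus <= G p t <= g_plus) ->
  forall b0 : N -> R[i],
  cmeasurable_fun P b0 ->
  forall Ainf : N -> set 'rV[R]_d,
  measurable ([set pt | P pt.1 /\ Ainf pt.1 pt.2] :
    set (Borel N * Borel 'rV[R]_d)) ->
  forall kappaG gamma : R, 0 < kappaG -> 0 < gamma ->
  gamma <= Num.min 1 kappaG ->
  {ae volP, forall p, P p ->
     normc (b p s - b0 p) @[s --> within (A p) (0 : 'rV[R]_d)^'] --> (0 : R)} ->
  {ae volP, forall p, P p ->
     phi p s / G p s @[s --> within (A p) (0 : 'rV[R]_d)^'] --> (1 : R)} ->
  (forall p s, P p -> trunc eps C p s -> kappaG * G p s <= phi p s) ->
  {ae volP, forall p, P p ->
     (\int[leb]_t (`|\1_(dil beta (z * c p) @` trunc eps C p) t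
                     - \1_(Ainf p) t| * expR (- gamma * G p t))%:E)%E
       @[z --> +oo] --> 0%E} ->
  forall B : N -> R,
  measurable_fun P B ->
  (forall p, P p -> 0 <= B p) ->
  (forall p s, P p -> trunc eps C p s -> normc (b p s) <= B p) ->
  (forall p, P p -> normc (b0 p) <= B p) ->
  volP.-integrable P (fun p => (B p * c p `^ (- Q))%:E) ->
  let L p := b0 p * (Rintegral leb (Ainf p) (fun t => expR (- G p t)))%:C%C in
  [/\ {ae volP, forall p, P p ->
         leb.-integrable (Ainf p) (fun t => (expR (- G p t))%:E)},
      cintegrable volP P (fun p => (c p `^ (- Q))%:C%C * L p),
      forall z, 0 < z ->
        {ae volP, forall p, P p ->
           cintegrable leb (trunc eps C p) (inner_integrand f a C z p)} /\
        cintegrable volP P (inner_integral f a eps C z) &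
      exists2 o : R -> R[i],
        normc (o z) @[z --> +oo] --> (0 : R) &
        forall z, 0 < z ->
          outer_integral volP f a eps C z =
          (expR (- z * f0) * z `^ (- Q))%:C%C *
            (cintegral volP P (fun p => (c p `^ (- Q))%:C%C * L p) + o z)].

Proof.
move=> C d P F A volP leb f0 b d_gt0 beta beta_gt0 Q c mc c_gt0 phi G mG G_ge0
  G_dil gl gu gl_gt0 _ G_rho b0 mb0 Ainf mAinf kappa gamma kappa_gt0 gamma_gt0
  gamma_le b_cvg phi_cvg phi_ge A_cvg B mB B_ge0 bB b0B iB L.
have [/(_ alpha)[_ hC] _ _ _] := hK.
have [[mP _ _] _ _ _ [mJ _ _]] := hC.
have mD := measurable_cell_dom hC; have mF := measurable_cell_map hC.
pose psi p s := f (F p s) - f0.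
have mpsi : measurable_fun (cell_dom eps C) (fun ps => psi ps.1 ps.2).
  apply: measurable_funB => //.
  by apply: measurableT_comp mF; exact: continuous_measurable_Borel.
have hG p : P p -> homogeneous_between beta gl gu (G p).
  by move=> Pp; split=> *; [exact: G_ge0|exact: G_dil|exact: G_rho].
pose J p := Rintegral leb (Ainf p) (fun t => expR (- G p t)).
pose T p := trunc eps C p.
(* The limits are assumed within the full cells, whereas the fibre lemmas integrate over the
   truncated ones; restriction to a subset preserves such limits. *)
have within_trunc p :
    within (T p) (0 : 'rV[R]_d)^' `=>` within (A p) (0 : 'rV[R]_d)^'.
  by apply: within_subset => s [].
have psi_cvg : {ae volP, forall p, P p ->
    psi p s / c p / G p s @[s --> within (T p) (0 : 'rV[R]_d)^'] --> (1 : R)}.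
  apply: filterS phi_cvg => p h Pp; apply: cvg_trans (h Pp).
  exact: cvg_app (within_trunc p).
have limit_integrable p : P p ->
    leb.-integrable (Ainf p) (fun t => (expR (- G p t))%:E).
  exact: (laplace_limit_integrable beta_gt0 mP gl_gt0 hG mG mAinf).
(* [pi] stands for the real or the imaginary part; compatibility with subtraction and real factors
   and domination by the modulus are what the real-valued results require of it. *)
have part (pi : R[i] -> R) :
    (forall x y, pi (x - y) = pi x - pi y) ->
    (forall x r, pi (x * r%:C%C) = pi x * r) ->
    (forall x, `|pi x| <= normc x) ->
    measurable_fun setT (pi \o a : Borel N -> R) ->
    measurable_fun P (pi \o b0) ->
  [/\ volP.-integrable P (fun p => (pi ((c p `^ (- Q))%:C%C * L p))%:E),
      forall z, 0 < z ->
        (forall p, P p -> leb.-integrable (T p)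
          (fun s => (pi (inner_integrand f a C z p s))%:E)) /\
        volP.-integrable P (fun p => (Rintegral leb (T p)
          (fun s => pi (inner_integrand f a C z p s)))%:E) &
      expR (z * f0) * z `^ Q * Rintegral volP P (fun p => Rintegral leb (T p)
          (fun s => pi (inner_integrand f a C z p s))) @[z --> +oo] -->
        Rintegral volP P (fun p => pi ((c p `^ (- Q))%:C%C * L p))].
  move=> piB piZ pi_le mpia mpib0.
  have mpib : measurable_fun (cell_dom eps C) (fun ps => pi (b ps.1 ps.2)).
    rewrite (_ : (fun ps => _) = fun ps => (pi \o a) (cell_map C ps) * cJ C ps.1 ps.2).
      by apply: measurable_funM => //; exact: measurableT_comp mF.
    by apply/funext => ps; rewrite /b /amplitude piZ.
  have pibB p s : P p -> T p s -> `|pi (b p s)| <= B p.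
    by move=> Pp Ts; apply: le_trans (pi_le _) _; exact: bB.
  have pib0B p : P p -> `|pi (b0 p)| <= B p.
    by move=> Pp; apply: le_trans (pi_le _) _; exact: b0B.
  have pib_cvg : {ae volP, forall p, P p ->
      pi (b p s) @[s --> within (T p) (0 : 'rV[R]_d)^'] --> pi (b0 p)}.
    apply: filterS b_cvg => p h Pp; apply/subr_cvg0/norm_cvg0P.
    have h0 : normc (b p s - b0 p) @[s --> within (T p) (0 : 'rV[R]_d)^'] --> (0 : R).
      by apply: cvg_trans (h Pp); exact: cvg_app (within_trunc p).
    apply: squeeze_cvgr _ (cvg_cst 0) h0; apply: nearW => s.
    by rewrite normr_ge0 -piB pi_le.
  have LE p : pi ((c p `^ (- Q))%:C%C * L p) = c p `^ (- Q) * (pi (b0 p) * J p).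
    by rewrite mulrC piZ /L piZ mulrC.
  (* Writing [f] as [f0 + psi] along the cell takes the factor [expR (- z * f0)] out of both
     integrals. *)
  have innerE z p s : pi (inner_integrand f a C z p s) =
      expR (- z * f0) * (pi (b p s) * expR (- z * psi p s)).
    rewrite /inner_integrand piZ mulrCA -expRD; congr (_ * expR _).
    by rewrite /psi /F; lra.
  have ik z p : 0 < z -> P p ->
      leb.-integrable (T p) (fun s => (pi (b p s) * expR (- z * psi p s))%:E).
    exact: (laplace_fiber_integrable beta_gt0 mP c_gt0 gl_gt0 hG mG mD mpib mpsi
      kappa_gt0 pibB phi_ge).
  have RE z p : 0 < z -> P p ->
      Rintegral leb (T p) (fun s => pi (inner_integrand f a C z p s)) =
      expR (- z * f0) *
        Rintegral leb (T p) (fun s => pi (b p s) * expR (- z * psi p s)).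
    move=> z0 Pp; under eq_Rintegral do rewrite innerE.
    by rewrite RintegralZl//; [exact: (measurable_trunc hC)|exact: ik].
  have iR z : 0 < z -> volP.-integrable P (fun p =>
      (Rintegral leb (T p) (fun s => pi (b p s) * expR (- z * psi p s)))%:E).
    exact: (laplace_inner_integrable beta_gt0 mP c_gt0 gl_gt0 hG mG mD mpib mpsi
      kappa_gt0 B_ge0 pibB phi_ge iB).
  split.
  - under eq_fun do rewrite LE.
    exact: (laplace_limit_outer_integrable beta_gt0 mP mc gl_gt0 hG mG mAinf
      mpib0 B_ge0 pib0B iB).
  - move=> z z0; split=> [p Pp|].
      under eq_fun do rewrite innerE EFinM.
      by apply: integrableZl; [exact: (measurable_trunc hC)|exact: ik].
    have := integrableZl mP (expR (- z * f0)) (iR z z0).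
    apply: eq_integrable => // p; rewrite inE => Pp.
    by rewrite RE// EFinM.
  under [X in _ --> X]eq_Rintegral do rewrite LE.
  have cv := laplace_cvg beta_gt0 d_gt0 mP mc c_gt0 gl_gt0 hG mG mD mAinf mpib mpsi
    mpib0 kappa_gt0 gamma_gt0 gamma_le B_ge0 pibB pib0B phi_ge iB pib_cvg psi_cvg A_cvg.
  (* Integrability of the inner integrals, and with it the factorization, holds for [z > 0], so the
     two functions are compared only eventually. *)
  apply: cvg_trans cv; apply: near_eq_cvg; near=> z.
  have z0 : 0 < z by near: z; apply: nbhs_pinfty_gt; exact: num_real.
  rewrite [in RHS](_ : Rintegral volP P _ = expR (- z * f0) * Rintegral volP P
    (fun p => Rintegral leb (T p) (fun s => pi (b p s) * expR (- z * psi p s)))).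
    by rewrite [RHS]mulrACA -expRD mulNr subrr expR0 mul1r.
  rewrite -RintegralZl//; last exact: iR.
  by apply: eq_Rintegral => p; rewrite inE => Pp; rewrite RE.
have [mRea mIma] := ha; have [mReb0 mImb0] := mb0.
have Re_sub (x y : R[i]) : complex.Re (x - y) = complex.Re x - complex.Re y.
  by case: x y => ? ? [].
have Im_sub (x y : R[i]) : complex.Im (x - y) = complex.Im x - complex.Im y.
  by case: x y => ? ? [].
have [iLRe ikRe cvgRe] := part (@complex.Re R) Re_sub (@Re_mul_real R)
  (@Re_le_normc R) mRea mReb0.
have [iLIm ikIm cvgIm] := part (@complex.Im R) Im_sub (@Im_mul_real R)
  (@Im_le_normc R) mIma mImb0.
split.
- by apply: aeW => p; exact: limit_integrable.
- by split.
- move=> z z0; have [ikRez ioRez] := ikRe z z0; have [ikImz ioImz] := ikIm z z0.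
  by split; [apply: aeW => p Pp; split; [exact: ikRez|exact: ikImz]|split].
set I0 := cintegral volP P _.
pose s z := expR (z * f0) * z `^ Q.
pose Iz z := outer_integral volP f a eps C z.
(* The error term is obtained by solving the asserted identity for it: [s z] is the inverse of the
   prefactor for [z > 0]. Its two components tend to 0 by [cvgRe] and [cvgIm]. *)
exists (fun z => Complex (s z * complex.Re (Iz z) - complex.Re I0)
                         (s z * complex.Im (Iz z) - complex.Im I0)).
  have sum0 : `|s z * complex.Re (Iz z) - complex.Re I0| +
      `|s z * complex.Im (Iz z) - complex.Im I0| @[z --> +oo] --> (0 : R).
    rewrite -[X in _ --> X](addr0 0); apply: cvgD;
      by apply/norm_cvg0P/subr_cvg0.
  apply: squeeze_cvgr _ (cvg_cst 0) sum0; apply: nearW => z.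
  rewrite (normc_le_ReIm (Complex _ _)) andbT.
  exact: sqrtr_ge0.
move=> z z0; rewrite -/(Iz z).
have ws : expR (- z * f0) * z `^ (- Q) * s z = 1.
  rewrite /s mulrACA -expRD mulNr addNr expR0 mul1r powRN mulVf//.
  by rewrite gt_eqF// powR_gt0.
have solve (x y : R[i]) (w r : R) : w * r = 1 ->
    x = w%:C%C * (y + Complex (r * complex.Re x - complex.Re y)
                              (r * complex.Im x - complex.Im y)).
  case: x y => [x1 x2] [y1 y2] wr; apply/eqP; rewrite eq_complex/=.
  by rewrite !mul0r subr0 addr0 ![_ + (_ - _)]addrC !subrK !mulrA wr !mul1r !eqxx.
exact: solve.
Unshelve. all: by end_near. Qed.
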